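(* Let $T>0$ and $r,\tau\ge 0$ with $r+\tau>0$. Let $f:\mathbb{R}^n\times\mathbb{R}^m\to\mathbb{R}^n$ be locally Lipschitz with $f(0,0)=0$. Suppose that: (i) the system $\dot x(t)=f(x(t),u(t))$ is forward complete; (ii) there exist $k\in C^1(\mathbb{R}^+\times\mathbb{R}^n;\mathbb{R}^m)$, $g\in K_\infty$ with $|k(t,x)|\le g(|x|)$ for all $(t,x)\in\mathbb{R}^+\times\mathbb{R}^n$, and a function $\sigma\in KL$ such that for every $(t_0,x_0)\in\mathbb{R}^+\times\mathbb{R}^n$ the solution $x(t)$ of $\dot x(t)=f(x(t),k(t,x(t)))$ with $x(t_0)=x_0$ satisfies $|x(t)|\le\sigma(|x_0|,t-t_0)$ for all $t\ge t_0$. For $t_0\ge 0$ put $\tau_i=t_0+iT$, $i\in Z^+$, and consider the closed-loop system $$\dot x(t)=f(x(t),u(t-\tau)),\quad t\ge t_0,$$ $$\dot z(t)=f(z(t),u(t)),\quad t\in[\tau_i,\tau_{i+1}),\ i\in Z^+,$$ $$z(\tau_{i+1})=\Phi\big(x(\tau_{i+1}-r),\breve T_{r+\tau}(\tau_{i+1})u\big),\quad i\in Z^+,$$ $$u(t)=k(t+\tau,z(t)),\quad t>t_0,$$ with initial condition $z(t_0)=z_0\in\mathbb{R}^n$, $T_{r+\tau}(t_0)u=u_0\in L^\infty([-r-\tau,0];\mathbb{R}^m)$, $T_r(t_0)x=x_0\in C^0([-r,0];\mathbb{R}^n)$, where $\Phi$ is the predictor mapping. Then the closed-loop system is uniformly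 globally asymptotically stable, in the sense that there exists a function $\tilde\sigma\in KL$ such that for every $t_0\ge 0$ and every $(x_0,z_0,u_0)\in C^0([-r,0];\mathbb{R}^n)\times\mathbb{R}^n\times L^\infty([-r-\tau,0];\mathbb{R}^m)$ the solution $(x(t),z(t),u(t))\in\mathbb{R}^n\times\mathbb{R}^n\times\mathbb{R}^m$ of the closed-loop system with this initial condition satisfies, for all $t\ge t_0$, $$|z(t)|+\|T_r(t)x\|_r+\|T_{r+\tau}(t)u\|_{r+\tau}\le\tilde\sigma\big(|z_0|+\|x_0\|_r+\|u_0\|_{r+\tau},\,t-t_0\big).$$
   Context: Notation. $\mathbb{R}^+=[0,\infty)$, $Z^+$ is the set of non-negative integers, $|\cdot|$ is the Euclidean norm. $K_\infty$ and $KL$ are the standard classes of comparison functions. For an interval $I$ and a set $U$, $L^\infty(I;U)$ (resp. $L^\infty_{loc}(I;U)$) is the space of measurable and bounded (resp. locally bounded) functions $I\to U$; functions differing on a null set are not identified. History: for a function $x$ defined on an interval containing $[t-r,t]$, $(T_r(t)x)(\theta)=x(t+\theta)$ for $\theta\in[-r,0]$ (history), and $(\breve T_r(t)x)(\theta)=x(t+\theta)$ for $\theta\in[-r,0)$ (open history). Norms: $\|x\|_r=\sup_{\theta\in[-r,0]}|x(\theta)|$ for functions on $[-r,0]$ and $\|x\|_r=\sup_{\theta\in[-r,0)}|x(\theta)|$ for functions on $[-r,0)$ (actual supremum, not essential supremum). Convention: $C^0([-r,0];\mathbb{R}^n)=\mathbb{R}^n$ when $r=0$. Forward completeness: $\dot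 x=f(x,u)$ is forward complete if for every $x_0\in\mathbb{R}^n$ and every measurable, locally bounded $u:\mathbb{R}^+\to\mathbb{R}^m$, the solution with $x(0)=x_0$ exists for all $t\ge0$. Solutions of differential equations are absolutely continuous functions satisfying the equation almost everywhere. Predictor mapping: under forward completeness, for $r+\tau>0$, $\Phi:\mathbb{R}^n\times L^\infty([-r-\tau,0);\mathbb{R}^m)\to\mathbb{R}^n$ is defined by $\Phi(x_0,u)=x(\tau)$, where $x(\cdot)$ is the solution of $\dot x(t)=f(x(t),u(t-\tau))$ on $[-r,\tau]$ with $x(-r)=x_0$. The signal $x(t-r)$ is the delayed measured output of the system; the controller uses it only at the sampling times $\tau_i$. *)

(* Defs.v *)
From HB Require Import structures.
From mathcomp Require Import all_boot all_order all_algebra.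
From mathcomp Require Import all_classical all_reals all_analysis.

Set Implicit Arguments.
Unset Strict Implicit.
Unset Printing Implicit Defensive.

Import Order.TTheory GRing.Theory Num.Theory.
Import numFieldNormedType.Exports.

Local Open Scope classical_set_scope.
Local Open Scope ring_scope.

(* Functions on an interval or on the half-space [0, +oo[ x R^n are represented
   by total functions; only the values on the stated domain are constrained. *)

(* Euclidean norm: the library norm `|v| on row vectors is the max norm. *)
Definition enorm (R : realType) (n : nat) (v : 'rV[R]_n) : R :=
  Num.sqrt (\sum_(i < n) v 0 i ^+ 2).

Section comparison_functions.
Context {R : realType}.

Definition class_K (g : R -> R) : Prop :=
  [/\ g 0 = 0,
      {within `[0, +oo[, continuous g} &
      {in `[0, +oo[ &, {homo g : s t / s < t}}].

Definition class_Kinfty (g : R -> R) : Prop :=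
  class_K g /\ g s @[s --> +oo] --> +oo.

Definition class_KL (sigma : R -> R -> R) : Prop :=
  [/\ {within [set p : R * R | 0 <= p.1 /\ 0 <= p.2],
         continuous (fun p : R * R => sigma p.1 p.2)},
      forall t, 0 <= t -> class_K (fun s => sigma s t) &
      forall s, 0 <= s ->
        {in `[0, +oo[ &, {homo sigma s : t1 t2 /~ t1 <= t2}} /\
        sigma s t @[t --> +oo] --> 0].

End comparison_functions.

Section regularity.
Context {R : realType}.

(* Unlike [measurableTypeR R], which carries the Borel sigma-algebra, this type
   carries the Lebesgue one. *)
Definition lebesgueTypeR := caratheodory_type (wlength (@idfun R))^*%mu.

Definition lebesgue_measurable_fun (m : nat) (I : set R) (u : R -> 'rV[R]_m) :
    Prop :=
  forall j : 'I_m,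
    measurable_fun (I : set lebesgueTypeR)
      (fun t => u t 0 j : measurableTypeR R).

Definition Linfty (m : nat) (I : set R) (u : R -> 'rV[R]_m) : Prop :=
  lebesgue_measurable_fun I u /\ [bounded u t | t in I].

Definition Linfty_loc (m : nat) (I : set R) (u : R -> 'rV[R]_m) : Prop :=
  lebesgue_measurable_fun I u /\
  forall a b : R, `[a, b] `<=` I -> [bounded u t | t in `[a, b]].

Definition abs_continuous (n : nat) (a b : R) (x : R -> 'rV[R]_n) : Prop :=
  forall e : R, 0 < e -> exists2 d : R, 0 < d &
    forall (N : nat) (l r : 'I_N -> R),
      (forall i, [/\ a <= l i, l i <= r i & r i <= b]) ->
      trivIset setT (fun i => [set` `]l i, r i[]) ->
      \sum_(i < N) (r i - l i) < d ->
      \sum_(i < N) enorm (x (r i) - x (l i)) < e.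

Definition locally_lipschitz (n m p : nat)
    (f : 'rV[R]_n -> 'rV[R]_m -> 'rV[R]_p) : Prop :=
  [locally [lipschitz f w.1 w.2 | w in [set: 'rV[R]_n * 'rV[R]_m]]].

(* C^1 on the non-open set [0, +oo[ x R^n: Frechet differentiable relative to
   that set (hence one-sidedly in t at t = 0), with a derivative (Dt, Dx) that
   is continuous up to the boundary. *)
Definition C1_halfspace (n m : nat) (k : R -> 'rV[R]_n -> 'rV[R]_m) : Prop :=
  let H := [set p : R * 'rV[R]_n | 0 <= p.1] in
  exists (Dt : R * 'rV[R]_n -> 'rV[R]_m) (Dx : R * 'rV[R]_n -> 'M[R]_(n, m)),
    [/\ {within H, continuous Dt},
        {within H, continuous Dx} &
        forall p, H p -> forall e : R, 0 < e ->
          \forall q \near within H (nbhs p),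
            enorm (k q.1 q.2 - k p.1 p.2
                   - ((q.1 - p.1) *: Dt p + (q.2 - p.2) *m Dx p))
            <= e * (`|q.1 - p.1| + enorm (q.2 - p.2))].

End regularity.

Section systems.
Context {R : realType}.

(* Solution of x'(t) = F t (x t) on the interval I. *)
Definition ode_solution (n : nat) (I : set R) (F : R -> 'rV[R]_n -> 'rV[R]_n)
    (x : R -> 'rV[R]_n) : Prop :=
  (forall a b : R, `[a, b] `<=` I -> abs_continuous a b x) /\
  {ae lebesgue_measure, forall t : R, I t -> is_derive t 1 x (F t (x t))}.

Definition forward_complete (n m : nat)
    (f : 'rV[R]_n -> 'rV[R]_m -> 'rV[R]_n) : Prop :=
  forall (x0 : 'rV[R]_n) (u : R -> 'rV[R]_m), Linfty_loc `[0, +oo[ u ->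
    exists x : R -> 'rV[R]_n,
      ode_solution `[0, +oo[ (fun t y => f y (u t)) x /\ x 0 = x0.

(* Both the history on [-s, 0] and the open history on [-s, 0[. *)
Definition history (V : Type) (t : R) (x : R -> V) : R -> V :=
  fun theta => x (t + theta).

(* Extended-real valued, because the real-valued [sup] of an unbounded set
   is 0. *)
Definition sup_norm (n : nat) (s : R) (x : R -> 'rV[R]_n) : \bar R :=
  ereal_sup [set (enorm (x theta))%:E | theta in `[- s, 0]].

(* The value u 0 is used at t = tau only, which is a null set: the result
   depends on u through its restriction to [-r-tau, 0[. *)
Definition predictor (n m : nat) (f : 'rV[R]_n -> 'rV[R]_m -> 'rV[R]_n)
    (r tau : R) (x0 : 'rV[R]_n) (u : R -> 'rV[R]_m) : 'rV[R]_n :=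
  xget 0 [set y | exists x : R -> 'rV[R]_n,
    [/\ ode_solution `[- r, tau] (fun t p => f p (u (t - tau))) x,
        x (- r) = x0 & x tau = y]].

Definition sampling_time (T t0 : R) (i : nat) : R := t0 + i%:R * T.

Record closed_loop_solution (n m : nat)
    (f : 'rV[R]_n -> 'rV[R]_m -> 'rV[R]_n) (k : R -> 'rV[R]_n -> 'rV[R]_m)
    (T r tau t0 : R)
    (x0 : R -> 'rV[R]_n) (z0 : 'rV[R]_n) (u0 : R -> 'rV[R]_m)
    (x z : R -> 'rV[R]_n) (u : R -> 'rV[R]_m) : Prop := ClosedLoopSolution {
  closed_loop_plant :
    ode_solution `[t0, +oo[ (fun t y => f y (u (t - tau))) x;
  closed_loop_flow : forall i : nat,
    ode_solution `[sampling_time T t0 i, sampling_time T t0 i.+1[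
      (fun t y => f y (u t)) z;
  closed_loop_jump : forall i : nat,
    z (sampling_time T t0 i.+1) =
      predictor f r tau (x (sampling_time T t0 i.+1 - r))
        (history (sampling_time T t0 i.+1) u);
  closed_loop_feedback : forall t : R, t0 < t -> u t = k (t + tau) (z t);
  closed_loop_init_z : z t0 = z0;
  closed_loop_init_u : {in `[- (r + tau), 0], history t0 u =1 u0};
  closed_loop_init_x : {in `[- r, 0], history t0 x =1 x0}
}.

End systems.

(* Main.v *)
Require Import Defs.
From HB Require Import structures.
From mathcomp Require Import all_boot all_order all_algebra.
From mathcomp Require Import all_classical all_reals all_analysis.
From mathcomp Require Import measurable_realfun ring lra.

Set Implicit Arguments.
Unset Strict Implicit.
Unset Printing Implicit Defensive.

Import Order.TTheory GRing.Theory Num.Theory.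
Import numFieldNormedType.Exports.

Local Open Scope classical_set_scope.
Local Open Scope ring_scope.

(** The predictor is exact once its measurement dates from after [t0]. At a
    sampling time later than [t0 + r], the plant, from [r] before to [tau] after
    that time, solves the very equation that defines the prediction, so uniqueness
    of solutions gives that [z] is then the state of the plant [tau] units of time
    ahead, and stays so since both obey the same equation ([flow_exact]). From
    then on the delayed input is the nominal feedback, the plant solves the
    nominal closed loop, and the estimate by [sigma] applies to the plant, to [z]
    and, through [g], to the input ([plant_decay]).

    There remain finitely many sampling periods, a number that depends on [T], [r]
    and [tau] only. Over these, all signals must be bounded by a class K function
    of the initial data ([uniform_bound]). Between two sampling times [z] obeys
    the nominal estimate, wherever it was restarted; this bounds the input, then
    the plant and the next prediction, by the gain of the system [x' = f(x, u)]
    over bounded times. The bound on the first periods and the later decay combine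
    into one class KL function ([class_KL_delay]).

    That gain exists by [reachable_class_K]. Near the origin it is linear, by
    comparison with the zero solution ([growth]). That it is finite at all is the
    theorem that forward completeness bounds the states reachable in bounded time
    from bounded data ([reachable_bounded0]). If it failed, some point would be
    explosive: trajectories issued from near it become arbitrarily large in the
    given time. Such trajectories cross any larger sphere, at points one of which
    is explosive again, and which can be met exactly by moving the initial state
    slightly, because trajectories can be steered backwards ([backward], a
    Banach fixed point). Iterating gives controls that drive smaller and smaller
    nested balls of initial states to larger and larger spheres; the trajectory of
    the concatenated control from the common point of the balls is unbounded in
    bounded time, against forward completeness.

    All comparisons of solutions rest on a mean value inequality for absolutely
    continuous functions with almost everywhere bounded derivative
    ([abs_cont_mean_value]), proved by a gauge argument without integrals.
    Existence is obtained period by period ([closed_loop_exists]). *)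

(** * Norms, compactness and absolute continuity *)

Section topology.
Context {R : realType}.

Lemma within_continuousP (V W : normedModType R) (A : set V) (h : V -> W) :
  {within A, continuous h} <->
  forall x, A x -> forall e : R, 0 < e -> exists2 d : R, 0 < d &
    forall y, A y -> `|y - x| < d -> `|h y - h x| < e.
Proof.
split=> [/subspace_continuousP hc x Ax e e0|hP].
  have /cvgrPdist_lt/(_ e e0)/nbhs_ballP[d /= d0 dP] := hc x Ax.
  by exists d => // y Ay yx; rewrite distrC; apply: (dP y); rewrite // -ball_normE /= distrC.
apply/subspace_continuousP => x Ax; apply/cvgrPdist_lt => e e0.
have [d d0 dP] := hP x Ax e e0; apply/nbhs_ballP; exists d => //= y.
by rewrite -ball_normE /= distrC => yx Ay; rewrite distrC; exact: dP.
Qed.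

(** Sequential form of compactness, without extracting a subsequence: indices as
    late as wanted come back near the cluster point. *)
Lemma compact_cluster (T : topologicalType) (K : set T) (w : nat -> T) :
  compact K -> (forall k, K (w k)) -> exists2 p, K p &
  forall A, nbhs p A -> forall k0, exists2 k, (k0 <= k)%N & A (w k).
Proof.
move=> cK wK; have [|p [Kp cl]] := cK (w @ \oo) _ _.
  by exists 0%N => // k _; exact: wK.
exists p => // A pA k0.
have [|v [[k k0k <-] Aw]] := cl (w @` [set k | (k0 <= k)%N]) A _ pA; last by exists k.
by exists k0 => // k k0k; exists k.
Qed.

End topology.

Lemma entry_le_norm {R : realType} {n p : nat} (A : 'M[R]_(n, p)) i j : `|A i j| <= `|A|.
Proof.
rewrite [leRHS]/Num.norm /= mx_normrE; apply/bigmax_geP; right => /=.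
by exists (i, j).
Qed.

Section norms.
Context {R : realType} {n : nat}.
Implicit Types v w : 'rV[R]_n.

Lemma enorm_ge0 v : 0 <= enorm v.
Proof. exact: sqrtr_ge0. Qed.

Lemma enorm0 : enorm (0 : 'rV[R]_n) = 0.
Proof.
by rewrite /enorm big1 ?sqrtr0// => i _; rewrite mxE expr0n.
Qed.

Lemma norm_le_entries v c : 0 <= c -> (forall i, `|v 0 i| <= c) -> `|v| <= c.
Proof.
move=> c0 vc; rewrite [leLHS]/Num.norm /= mx_normrE; apply/bigmax_leP; split => //.
by move=> [i j] _ /=; rewrite (ord1 i).
Qed.

Lemma norm_le_enorm v : `|v| <= enorm v.
Proof.
apply: norm_le_entries; first exact: enorm_ge0.
move=> i; rewrite -sqrtr_sqr; apply: ler_wsqrtr.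
by rewrite (bigD1 i)//= lerDl sumr_ge0// => j _; exact: sqr_ge0.
Qed.

Lemma enorm_le_norm v : enorm v <= n%:R * `|v|.
Proof.
have nv0 : 0 <= n%:R * `|v| by rewrite mulr_ge0.
rewrite -[leRHS]ger0_norm// -sqrtr_sqr; apply: ler_wsqrtr.
apply: (@le_trans _ _ (\sum_(i < n) `|v| ^+ 2)).
  apply: ler_sum => i _; rewrite -real_normK ?num_real//.
  by rewrite lerXn2r ?nnegrE// entry_le_norm.
rewrite sumr_const card_ord exprMn -[leLHS]mulr_natl ler_wpM2r ?sqr_ge0//.
rewrite -natrX ler_nat; case: n => // k; exact: leq_pmull.
Qed.

End norms.

Section absolute_continuity.
Context {R : realType}.

(** Unlike [enorm], the norm of the normed module structure, here the max norm,
    is the one that derivatives refer to; the two are equivalent. *)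
Definition abs_cont_norm (V : normedModType R) (a b : R) (x : R -> V) : Prop :=
  forall e : R, 0 < e -> exists2 d : R, 0 < d &
    forall (N : nat) (l r : 'I_N -> R),
      (forall i, [/\ a <= l i, l i <= r i & r i <= b]) ->
      trivIset setT (fun i => [set` `]l i, r i[]) ->
      \sum_(i < N) (r i - l i) < d ->
      \sum_(i < N) `|x (r i) - x (l i)| < e.

Lemma abs_continuousE (n : nat) (a b : R) (x : R -> 'rV[R]_n) :
  abs_continuous a b x <-> abs_cont_norm a b x.
Proof.
split=> ax e e0.
  have [d d0 dP] := ax e e0; exists d => // N l r lr tr sd.
  apply: le_lt_trans (dP N l r lr tr sd).
  by apply: ler_sum => i _; exact: norm_le_enorm.
have [|d d0 dP] := ax (e / n.+1%:R); first by rewrite divr_gt0.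
exists d => // N l r lr tr sd.
apply: (@le_lt_trans _ _ (n.+1%:R * \sum_(i < N) `|x (r i) - x (l i)|)).
  rewrite mulr_sumr; apply: ler_sum => i _.
  by apply: le_trans (enorm_le_norm _) _; rewrite ler_wpM2r// ler_nat.
by rewrite -ltr_pdivlMl// mulrC; exact: dP.
Qed.

Lemma abs_cont_normB (V : normedModType R) (a b : R) (x y : R -> V) :
  abs_cont_norm a b x -> abs_cont_norm a b y ->
  abs_cont_norm a b (fun t => x t - y t).
Proof.
move=> ax ay e e0.
have e20 : 0 < e / 2 by rewrite divr_gt0.
have [d1 d10 d1P] := ax _ e20; have [d2 d20 d2P] := ay _ e20.
exists (Num.min d1 d2) => [|N l r lr tr]; first by rewrite lt_min d10.
rewrite lt_min => /andP[s1 s2].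
rewrite (splitr e); apply: le_lt_trans (ltrD (d1P _ _ _ lr tr s1) (d2P _ _ _ lr tr s2)).
rewrite -big_split/=; apply: ler_sum => i _.
have -> : x (r i) - y (r i) - (x (l i) - y (l i)) =
    (x (r i) - x (l i)) - (y (r i) - y (l i)) by rewrite !opprD !opprK addrACA.
exact: ler_normB.
Qed.

Lemma abs_cont_norm_shift (V : normedModType R) (a b c : R) (x : R -> V) :
  abs_cont_norm (a + c) (b + c) x -> abs_cont_norm a b (fun t => x (t + c)).
Proof.
move=> ax e e0; have [d d0 dP] := ax e e0; exists d => // N l r lr tr sd.
apply: (dP N (fun i => l i + c) (fun i => r i + c)).
- by move=> i; have [h1 h2 h3] := lr i; split; rewrite lerD2r.
- apply/trivIsetP => i j _ _ ij; move/trivIsetP: tr => /(_ i j Logic.I Logic.I ij).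
  move=> /seteqP[+ _]; move=> lr0; apply/seteqP; split => // t /= [].
  rewrite !in_itv/= => /andP[t1 t2] /andP[t3 t4].
  apply: (lr0 (t - c)); split => /=; rewrite in_itv/=; apply/andP; split; lra.
- by rewrite (eq_bigr (fun i => r i - l i))// => i _; lra.
Qed.

(** Each interval of a disjoint family is cut at the gluing point. *)
Lemma abs_cont_norm_glue (V : normedModType R) (a b c : R) (x y : R -> V) :
  a <= b -> b <= c -> x b = y b ->
  abs_cont_norm a b x -> abs_cont_norm b c y ->
  abs_cont_norm a c (fun t => if t <= b then x t else y t).
Proof.
move=> ab bc xyb ax ay e e0.
have e20 : 0 < e / 2 by rewrite divr_gt0.
have [d1 d10 d1P] := ax _ e20; have [d2 d20 d2P] := ay _ e20.
exists (Num.min d1 d2) => [|N l r lr tr]; first by rewrite lt_min d10.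
rewrite lt_min => /andP[s1 s2].
have lr' i : l i <= r i by have [] := lr i.
have trim (p : R -> R) : (forall u v, u <= v -> p u <= p v) ->
    (forall u v t, u <= v -> p u < t -> t < p v -> u < t /\ t < v) ->
    trivIset setT (fun i => [set` `]p (l i), p (r i)[]).
  move=> hp hp2; apply/trivIsetP => i j _ _ ij.
  move/trivIsetP: tr => /(_ i j Logic.I Logic.I ij).
  move=> /seteqP[+ _]; move=> lr0; apply/seteqP; split => // t /= [].
  rewrite !in_itv/= => /andP[t1 t2] /andP[t3 t4].
  by apply: (lr0 t); split => /=; rewrite in_itv/=; apply/andP;
    [apply: (hp2 (l i) (r i))|apply: (hp2 (l j) (r j))].
have D1 : \sum_(i < N) `|x (Num.min (r i) b) - x (Num.min (l i) b)| < e / 2.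
  apply: d1P.
  - move=> i; have [h1 h2 h3] := lr i.
    by rewrite le_min h1 ab le_min !ge_min h2 lexx !orbT.
  - apply: (trim (fun t => Num.min t b)) => [u v uv|u v t uv].
      by rewrite le_min !ge_min uv lexx !orbT.
    by rewrite gt_min lt_min => /orP[ut|bt] /andP[tv tb]; split => //; lra.
  - apply: le_lt_trans s1; apply: ler_sum => i _.
    have := lr' i; rewrite /Num.min; case: ifPn; case: ifPn; rewrite -?leNgt; lra.
have D2 : \sum_(i < N) `|y (Num.max (r i) b) - y (Num.max (l i) b)| < e / 2.
  apply: d2P.
  - move=> i; have [h1 h2 h3] := lr i.
    by rewrite le_max ge_max !le_max ge_max h2 h3 bc lexx !orbT.
  - apply: (trim (fun t => Num.max t b)) => [u v uv|u v t uv].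
      by rewrite ge_max !le_max uv lexx !orbT.
    by rewrite gt_max lt_max => /andP[ut bt] /orP[tv|tb]; split => //; lra.
  - apply: le_lt_trans s2; apply: ler_sum => i _.
    have := lr' i; rewrite /Num.max; case: ifPn; case: ifPn; rewrite -?leNgt; lra.
rewrite (splitr e); apply: le_lt_trans (ltrD D1 D2).
rewrite -big_split/=; apply: ler_sum => i _.
have glueE t : (if t <= b then x t else y t) =
    x (Num.min t b) + (y (Num.max t b) - y b).
  by case: (leP t b) => tb; [rewrite subrr addr0|rewrite xyb addrC subrK].
rewrite !glueE opprD addrACA opprB subrKA.
exact: ler_normD.
Qed.

Lemma abs_cont_norm_continuous (V : normedModType R) (a b : R) (x : R -> V) :
  abs_cont_norm a b x -> forall t e : R, a <= t <= b -> 0 < e ->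
  exists2 d : R, 0 < d & forall s, a <= s <= b -> `|s - t| < d ->
    `|x s - x t| < e.
Proof.
move=> ax t e /andP[at_ tb] e0; have [d d0 dP] := ax e e0; exists d => //.
move=> s /andP[as_ sb] st.
have tr1 (l r : 'I_1 -> R) : trivIset setT (fun i => [set` `]l i, r i[]).
  by apply/trivIsetP => i j _ _; rewrite (ord1 i) (ord1 j) eqxx.
have [ts|/ltW ts] := leP t s.
  have := dP 1%N (fun=> t) (fun=> s); rewrite !big_ord1; apply => //.
  by rewrite -(ger0_norm (_ : 0 <= s - t))// subr_ge0.
have := dP 1%N (fun=> s) (fun=> t); rewrite !big_ord1 distrC; apply => //.
by rewrite -(ger0_norm (_ : 0 <= t - s)) 1?distrC// subr_ge0.
Qed.

End absolute_continuity.

(** * Mean value inequality for absolutely continuous functions *)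

Section mean_value.
Context {R : realType}.
Local Notation mu := (@lebesgue_measure R).

(** Straddle form of differentiability: the two end points lie on either side of
    [t], so that consecutive intervals can be chained without controlling the
    differentiation point inside each of them. *)
Lemma is_derive_gauge (V : normedModType R) (x : R -> V) (t : R) (d : V) (e : R) :
  is_derive t 1 x d -> 0 < e -> exists2 dl : R, 0 < dl &
    forall u v, t - dl < u -> u <= t -> t <= v -> v < t + dl ->
    `|x v - x u| <= (`|d| + e) * (v - u).
Proof.
move=> [xt dE] e0; have := xt; rewrite /derivable => /cvg_ex[d' xd'].
have dd' : d = d' by rewrite -dE; apply: cvg_lim xd'.
move: xd'; rewrite -dd' => /cvgrPdist_lt /(_ e e0) /nbhs_ballP[dl /= dl0 dlP].
have step h : `|h| < dl -> `|x (t + h) - x t| <= (`|d| + e) * `|h|.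
  have [->|h0] := eqVneq h 0; first by rewrite addr0 subrr !normr0 mulr0.
  move=> hdl; have := dlP h.
  rewrite /ball /= sub0r normrN => /(_ hdl h0).
  have -> : h *: (1 : R) + t = t + h by rewrite addrC [_ *: _]mulr1.
  move=> dh; rewrite -ler_pdivrMr ?normr_gt0// mulrC -normfV -normrZ.
  rewrite -[X in `|X| <= _](subrK d) addrC.
  by rewrite (le_trans (ler_normD _ _))// lerD2l distrC ltW.
exists dl => // u v tu ut tv vt.
have -> : x v - x u = (x v - x t) - (x u - x t) by rewrite opprB subrKA.
apply: le_trans (ler_normB _ _) _.
have := step (v - t); have := step (u - t).
rewrite !(addrC t) !subrK (ger0_norm (_ : 0 <= v - t)) ?subr_ge0//.
rewrite (ler0_norm (_ : u - t <= 0)) ?subr_le0// => h1 h2.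
have := lerD (h2 _) (h1 _).
by rewrite -mulrDr opprB subrKA => -> //; lra.
Qed.

(** The points where the derivative is missing or too large lie in an open set
    [G] of measure so small that absolute continuity makes the total increment
    over intervals of [G] negligible; elsewhere the increment is bounded by the
    derivative. The gauge argument runs by continuous induction on [t], with
    the length of the exceptional intervals compared to the measure of [G]. *)
Lemma abs_cont_mean_value (V : normedModType R) (x : R -> V) (a b M : R) :
  a <= b -> 0 <= M -> abs_cont_norm a b x ->
  {ae mu, forall t, a <= t <= b -> exists2 d : V, is_derive t 1 x d & `|d| <= M} ->
  `|x b - x a| <= M * (b - a).
Proof.
move=> ab M0 ax aed; apply/ler_addgt0Pr => e e0.
have ba1 : 0 < b - a + 1 by lra.
pose ep := e / (b - a + 1).
have ep0 : 0 < ep by rewrite divr_gt0.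
have epE : ep * (b - a) + ep = e.
  by rewrite -{2}[ep]mulr1 -mulrDr /ep divfK// gt_eqF.
have [dl dl0 dlP] := ax _ ep0.
pose B := ~` [set t | a <= t <= b -> exists2 d : V, is_derive t 1 x d & `|d| <= M].
have B0 : ((@wlength R idfun)^* B)%mu = 0%E.
  exact/negligible_outer_measure/aed.
have [|G [oG BG muG]] := @outer_measure_open_le R B (dl / 2).
  by rewrite divr_gt0.
rewrite B0 add0e in muG.
have Mep0 : 0 <= M + ep by lra.
pose P t := exists (N : nat) (l r : 'I_N -> R),
  [/\ (forall i, [/\ a <= l i, l i <= r i & r i <= t]),
      trivIset setT (fun i => [set` `]l i, r i[]),
      ((\sum_(i < N) (r i - l i))%:E <= mu (G `&` [set` `[a, t]]))%E &
      `|x t - x a| <= (M + ep) * (t - a) + \sum_(i < N) `|x (r i) - x (l i)|].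
have mG t : measurable (G `&` [set` `[a, t]] : set R).
  by apply: measurableI => //; exact: open_measurable.
have muGS s t : s <= t -> (mu (G `&` [set` `[a, s]]) <= mu (G `&` [set` `[a, t]]))%E.
  move=> st; apply: le_measure; rewrite ?inE; [exact: mG|exact: mG|].
  by apply: setIS => z /=; rewrite !in_itv/= => /andP[-> /le_trans]; exact.
have Pa : P a.
  exists 0%N, (fun=> 0), (fun=> 0); split; first by case.
  - by apply/trivIsetP; case.
  - by rewrite big_ord0 measure_ge0.
  - by rewrite !subrr normr0 mulr0 big_ord0 add0r.
have good u v : u <= v -> `|x v - x u| <= (M + ep) * (v - u) -> P u -> P v.
  move=> uv xuv [N [l [r [lr tr sl xl]]]]; exists N, l, r; split => //.
  - by move=> i; have [h1 h2 h3] := lr i; split => //; exact: le_trans uv.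
  - exact: le_trans (muGS _ _ uv).
  - have -> : x v - x a = (x v - x u) + (x u - x a) by rewrite addrA subrK.
    by apply: le_trans (ler_normD _ _) _; lra.
have bad u v : a <= u -> u <= v -> (forall s, u <= s -> s <= v -> G s) ->
    P u -> P v.
  move=> au uv Guv [N [l [r [lr tr sl xl]]]].
  pose l' (i : 'I_N.+1) := if unlift ord0 i is Some j then l j else u.
  pose r' (i : 'I_N.+1) := if unlift ord0 i is Some j then r j else v.
  exists N.+1, l', r'; split.
  - move=> i; rewrite /l' /r'; case: unliftP => [j _|_] //.
    by have [h1 h2 h3] := lr j; split => //; exact: le_trans uv.
  - apply/trivIsetP => i j _ _; rewrite /l' /r'.
    have old k : [set` `]l k, r k[] `&` [set` `]u, v[] = set0.
      have [h1 h2 h3] := lr k; apply/seteqP; split => // t /= [].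
      by rewrite !in_itv/= => /andP[_ tr'] /andP[ut _]; lra.
    case: unliftP => [i' ->|->]; case: unliftP => [j' ->|->] ij //.
    + by move/trivIsetP: tr; apply => //; apply: contra ij => /eqP ->.
    + by rewrite setIC; exact: old.
  - rewrite big_ord_recl /l' /r' unlift_none.
    under eq_bigr do rewrite liftK.
    rewrite addrC EFinD.
    have muv : mu [set` `]u, v]] = (v - u)%:E.
      rewrite lebesgue_measure_itv/= lte_fin.
      by case: ltP => // vu; rewrite (_ : v - u = 0)//; lra.
    rewrite -muv; apply: (@le_trans _ _ (mu (G `&` [set` `[a, u]]) + mu [set` `]u, v]])%E).
      exact: leeD2r.
    rewrite -measureU//=.
      apply: le_measure; rewrite ?inE; [apply: measurableU => //; exact: mG|exact: mG|].
      move=> t /= [[Gt]|]; rewrite !in_itv/= => /andP[h1 h2].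
        by split => //; rewrite h1/= (le_trans h2).
      by split; [apply: Guv => //; exact: ltW|rewrite h2 andbT; lra].
    exact: mG.
    apply/seteqP; split => // t /= [[_]].
    by rewrite !in_itv/= => /andP[h1 h2] /andP[h3 h4]; lra.
  - rewrite big_ord_recl /l' /r' unlift_none.
    under eq_bigr do rewrite liftK.
    have -> : x v - x a = (x v - x u) + (x u - x a) by rewrite addrA subrK.
    apply: le_trans (ler_normD _ _) _.
    have : 0 <= (M + ep) * (v - u) by rewrite mulr_ge0// subr_ge0.
    by lra.
have gauge t : a <= t <= b -> exists2 h : R, 0 < h & forall u v, a <= u ->
    t - h < u -> u <= t -> t <= v -> v < t + h -> P u -> P v.
  move=> tab; have [Bt|nBt] := pselect (B t).
    have /nbhs_ballP[h /= h0 hG] : nbhs t G.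
      by apply: open_nbhs_nbhs; split => //; exact: BG.
    exists h => // u v au hu ut tv vh; apply: bad => // [|s us sv].
      exact: le_trans tv.
    by apply: hG; rewrite /ball/= ltr_norml; apply/andP; split; lra.
  have [d xd dM] : exists2 d : V, is_derive t 1 x d & `|d| <= M.
    by move: nBt => /contrapT; exact.
  have [h h0 hP] := is_derive_gauge xd ep0.
  exists h => // u v au hu ut tv vh; apply: good; first exact: le_trans tv.
  apply: le_trans (hP _ _ hu ut tv vh) _.
  by rewrite ler_wpM2r ?lerD2r// subr_ge0 (le_trans ut).
pose S := [set t | a <= t <= b /\ P t].
have Sa : S a by split; rewrite ?lexx.
have hS : has_sup S by split; [exists a|exists b => t [/andP[]]].
pose c := sup S.
have supub := sup_upper_bound hS.
have ac : a <= c by exact: supub.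
have cb : c <= b by apply: ge_sup; [exists a|move=> t [/andP[]]].
have [h h0 hP] := gauge c (introT andP (conj ac cb)).
have [u [/andP[au ub] Pu] cu] := sup_adherent h0 hS.
have uc : u <= c by apply: supub; split => //; rewrite au.
have Pc' v : c <= v -> v < c + h -> P v by move=> cv vh; exact: (hP u v).
have bc : c = b.
  apply/eqP; rewrite eq_le cb leNgt; apply/negP => lcb.
  pose v := Num.min b (c + h / 2).
  have vb : v <= b by rewrite /v ge_min lexx.
  have cv : c < v by rewrite /v lt_min lcb/=; lra.
  have vh : v < c + h by rewrite /v gt_min; apply/orP; right; lra.
  have : v <= c.
    apply: supub; split; first by rewrite vb andbT; lra.
    by apply: Pc' => //; exact: ltW.
  by rewrite leNgt cv.
have [N [l [r [lr tr sl xl]]]] : P b by rewrite -bc; apply: Pc' => //; lra.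
apply: le_trans xl _.
have /ltW : \sum_(i < N) `|x (r i) - x (l i)| < ep.
  apply: dlP => //; rewrite -lte_fin.
  apply: le_lt_trans sl _; apply: (@le_lt_trans _ _ (mu G)).
    by apply: le_measure; rewrite ?inE; [exact: mG|exact: open_measurable|exact: subIsetl].
  by apply: le_lt_trans muG _; rewrite lte_fin; lra.
by rewrite mulrDl -epE; lra.
Qed.

End mean_value.

(** * Translation and Lebesgue measurability *)

Section translation.
Context {R : realType}.
Local Notation mu := (@lebesgue_measure R).
Local Notation outer := ((@wlength R idfun)^*%mu).

Let shift_set (c : R) (A : set R) : set R := [set t | A (t + c)].

Let outer_shift_le c (A : set R) : (outer (shift_set c A) <= outer A)%E.
Proof.
rewrite !outer_measure_open_itv_cover; apply: le_ereal_inf_tmp => _ [F [Fo AF] <-].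
apply: ereal_inf_lbound; exists (fun i => shift_set c (F i)).
  split=> [i|t /AF[i _ Fit]]; last by exists i.
  have [[a b] /= ->] := Fo i; exists (a - c, b - c) => /=.
  by apply/seteqP; split => t; rewrite /shift_set /= !in_itv/=;
    move=> /andP[? ?]; apply/andP; split; lra.
apply: eq_eseriesr => i _; have [[a b] /= ->] := Fo i.
have -> : shift_set c [set` `]a, b[] = [set` `](a - c), (b - c)[].
  by apply/seteqP; split => t; rewrite /shift_set /= !in_itv/=;
    move=> /andP[? ?]; apply/andP; split; lra.
by rewrite !wlength_itv/= !lte_fin ltrD2r -!EFinD; case: ifP => // _; congr EFin; lra.
Qed.

Let shift_setK c A : shift_set c (shift_set (- c) A) = A.
Proof. by apply/seteqP; split => t; rewrite /shift_set /= addrK. Qed.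

(** The outer measure is an infimum over covers by open intervals, and translation
    preserves these covers and their lengths. *)
Lemma outer_measure_shift c (A : set R) : outer [set t | A (t + c)] = outer A.
Proof.
apply/eqP; rewrite eq_le outer_shift_le/=.
rewrite -{1}(shift_setK (- c) A) opprK.
exact: (outer_shift_le (- c) (shift_set c A)).
Qed.

Lemma ae_shift (P : R -> Prop) (c : R) :
  {ae mu, forall t, P t} -> {ae mu, forall t, P (t + c)}.
Proof.
move=> /negligible_outer_measure P0; apply/negligible_outer_measure.
exact: etrans (outer_measure_shift c (~` [set t | P t])) P0.
Qed.

(** Lebesgue measurable sets, unlike Borel ones, are not generated by intervals;
    but the Caratheodory criterion mentions the outer measure only, which
    translation preserves. *)
Lemma lebesgue_measurable_shift c (A : set R) :
  measurable (A : set (@lebesgueTypeR R)) ->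
  measurable ([set t | A (t + c)] : set (@lebesgueTypeR R)).
Proof.
move=> mA; have cA : caratheodory_measurable outer A := mA.
change (caratheodory_measurable outer [set t | A (t + c)]) => X.
rewrite -(outer_measure_shift (- c) X) (cA [set t | X (t - c)]).
rewrite -(outer_measure_shift c (_ `&` A)) -(outer_measure_shift c (_ `&` ~` A)).
by congr (outer _ + outer _)%E; apply/seteqP; split => t /=; rewrite addrK.
Qed.

Lemma lebesgue_measurable_fun_shift (m : nat) (I : set R) (u : R -> 'rV[R]_m) (c : R) :
  lebesgue_measurable_fun I u ->
  lebesgue_measurable_fun [set t | I (t + c)] (fun t => u (t + c)).
Proof.
move=> mu' j mIc Y mY.
have mI : measurable (I : set (@lebesgueTypeR R)).
  have := lebesgue_measurable_shift (- c) mIc.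
  by congr (measurable _); apply/seteqP; split => t /=; rewrite subrK.
exact: (lebesgue_measurable_shift c (mu' j mI Y mY)).
Qed.

End translation.

Section lebesgue_measurable_functions.
Context {R : realType} {m : nat}.
Implicit Types (I J : set R) (u v : R -> 'rV[R]_m).

Lemma borel_lebesgue I : measurable (I : set (measurableTypeR R)) ->
  measurable (I : set (@lebesgueTypeR R)).
Proof. exact: sub_caratheodory. Qed.

Lemma lebesgue_measurable_itv (i : interval R) :
  measurable ([set` i] : set (@lebesgueTypeR R)).
Proof. by apply: borel_lebesgue; exact: measurable_itv. Qed.

Lemma lebesgue_measurable_funS I J u :
  measurable (I : set (@lebesgueTypeR R)) -> J `<=` I ->
  lebesgue_measurable_fun I u -> lebesgue_measurable_fun J u.
Proof. by move=> mI JI mIu j; apply: measurable_funS mI JI (mIu j). Qed.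

Lemma lebesgue_measurable_funU I J u :
  measurable (I : set (@lebesgueTypeR R)) ->
  measurable (J : set (@lebesgueTypeR R)) ->
  lebesgue_measurable_fun I u -> lebesgue_measurable_fun J u ->
  lebesgue_measurable_fun (I `|` J) u.
Proof. by move=> mI mJ mIu mJu j; apply/(measurable_funU _ mI mJ); split. Qed.

Lemma eq_lebesgue_measurable_fun I u v : (forall t, I t -> u t = v t) ->
  lebesgue_measurable_fun I u -> lebesgue_measurable_fun I v.
Proof.
move=> uv mIu j; apply: eq_measurable_fun (mIu j) => t; rewrite inE => It.
by rewrite uv.
Qed.

Lemma lebesgue_measurable_fun_cst I (w : 'rV[R]_m) :
  lebesgue_measurable_fun I (fun=> w).
Proof. by move=> j; exact: measurable_cst. Qed.

Lemma lebesgue_measurable_fun1 (a : R) u : lebesgue_measurable_fun [set a] u.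
Proof.
apply: (@eq_lebesgue_measurable_fun _ (fun=> u a)) => [t ->//|].
exact: lebesgue_measurable_fun_cst.
Qed.

Lemma lebesgue_measurable_fun_continuous I u : open I ->
  (forall t, I t -> {for t, continuous u}) -> lebesgue_measurable_fun I u.
Proof.
move=> oI uc j _ Y mY; apply: borel_lebesgue.
apply: (@open_continuous_measurable_fun _ I (fun t => u t 0 j)) => //.
  move=> t; rewrite inE => It; have := uc t It.
  by move=> /(continuous_comp) /(_ (@coord_continuous _ _ _ 0 j _)).
exact: open_measurable.
Qed.

End lebesgue_measurable_functions.

(** * Solutions of differential equations *)

Section ode.
Context {R : realType} {n : nat}.
Local Notation V := 'rV[R]_n.
Local Notation mu := (@lebesgue_measure R).
Implicit Types (I J : set R) (F G : R -> V -> V) (x y : R -> V).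

Lemma negligible1 (a : R) : mu.-negligible [set a].
Proof. by exists [set a]; split => //; exact: lebesgue_measure_set1. Qed.

Let ae_imp (P Q : R -> Prop) : (forall t, P t -> Q t) ->
  {ae mu, forall t, P t} -> {ae mu, forall t, Q t}.
Proof. by move=> PQ; apply: negligibleS => t /= nQ /PQ. Qed.

Let ae_imp2 (P Q S : R -> Prop) : (forall t, P t -> Q t -> S t) ->
  {ae mu, forall t, P t} -> {ae mu, forall t, Q t} -> {ae mu, forall t, S t}.
Proof.
move=> PQS aP aQ; apply: negligibleS (negligibleU aP aQ) => t /= nS.
by apply/not_andP => -[Pt Qt]; exact: nS (PQS t Pt Qt).
Qed.

Lemma eq_abs_continuous (a b : R) x y : (forall t, a <= t <= b -> x t = y t) ->
  abs_continuous a b x -> abs_continuous a b y.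
Proof.
move=> xy ax e e0; have [d d0 dP] := ax e e0; exists d => // N l r lr tr sd.
rewrite (eq_bigr (fun i => enorm (x (r i) - x (l i)))); first exact: dP.
by move=> i _; have [h1 h2 h3] := lr i; rewrite !xy// ?h3 ?h1 ?andbT//=;
  [exact: le_trans h3|exact: le_trans h2].
Qed.

(** The derivative is a two-sided one, so changing a function off [I] may spoil
    it at the boundary of [I]; this is harmless when the boundary is null. *)
Lemma eq_ode_solution I F G x y (E : set R) : mu.-negligible E ->
  (forall t, I t -> x t = y t) ->
  (forall t, I t -> ~ E t -> nbhs t I) ->
  (forall t, I t -> ~ E t -> F t (x t) = G t (x t)) ->
  ode_solution I F x -> ode_solution I G y.
Proof.
move=> E0 xy nI FG [ax dx]; split.
  move=> a b abI; apply: eq_abs_continuous (ax a b abI) => t tab; apply: xy.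
  by apply: abI; rewrite /= in_itv.
have nE : {ae mu, forall t, ~ E t}.
  by apply: negligibleS E0 => t /= /contrapT.
apply: ae_imp2 dx nE => t xt nEt It.
rewrite -xy// -FG//; have tI := nI t It nEt.
apply: (near_eq_is_derive _ (xt It)).
by near=> s; rewrite xy//; near: s.
Unshelve. all: by end_near. Qed.

Lemma ode_solutionS I J F x : J `<=` I -> ode_solution I F x -> ode_solution J F x.
Proof.
move=> JI [ax dx]; split; first by move=> a b abJ; apply: ax; exact: subset_trans JI.
by apply: ae_imp dx => t xt /JI.
Qed.

Lemma eq_ode_rhs I F G x (E : set R) : mu.-negligible E ->
  (forall t, I t -> ~ E t -> F t (x t) = G t (x t)) ->
  ode_solution I F x -> ode_solution I G x.
Proof.
move=> E0 FG [ax dx]; split => //.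
have nE : {ae mu, forall t, ~ E t} by apply: negligibleS E0 => t /= /contrapT.
by apply: ae_imp2 dx nE => t xt nEt It; rewrite -FG//; exact: xt.
Qed.

Lemma is_derive_shift x (t c : R) (d : V) :
  is_derive (t + c) 1 x d -> is_derive t 1 (fun s => x (s + c)) d.
Proof.
have E : (fun h : R => h^-1 *: (((fun s => x (s + c)) \o shift t) (h *: 1) - x (t + c)))
    = (fun h => h^-1 *: ((x \o shift (t + c)) (h *: 1) - x (t + c))).
  by apply/funext => h /=; rewrite addrA.
by move=> [d1 d2]; split; [rewrite /derivable E|rewrite /derive E].
Qed.

Lemma ode_solution_shift I F x (c : R) : ode_solution I F x ->
  ode_solution [set t | I (t + c)] (fun t => F (t + c)) (fun t => x (t + c)).
Proof.
move=> [ax dx]; split.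
  move=> a b abI; apply/abs_continuousE/abs_cont_norm_shift/abs_continuousE/ax.
  move=> t /=; rewrite in_itv/= => tab.
  have : `[a, b]%classic (t - c) by rewrite /= in_itv/=; apply/andP; split; lra.
  by move=> /abI /=; rewrite subrK.
apply: ae_imp (ae_shift c dx) => t h It; apply: is_derive_shift; exact: h.
Qed.

(** The glued function may fail to be differentiable at [b], a null set. *)
Lemma ode_solution_glue I J F x y (a b : R) :
  (forall t, I t -> a <= t) -> (forall t, I t -> b <= t -> J t) -> x b = y b ->
  ode_solution `[a, b] F x -> ode_solution J F y ->
  ode_solution I F (fun t => if t <= b then x t else y t).
Proof.
move=> Ia IJ xyb [ax dx] [ay dy]; split.
  move=> p q pqI; have [qp|pq] := ltP q p.
    move=> e e0; exists 1 => // N l r lr _ _; case: N l r lr => [|N] l r lr.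
      by rewrite big_ord0.
    by have [h1 h2 h3] := lr ord0; lra.
  have ap : a <= p by apply/Ia/pqI; rewrite /= in_itv/= lexx.
  have [qb|bq] := leP q b.
    apply: (@eq_abs_continuous _ _ x) => [t /andP[_ tq]|].
      by rewrite (le_trans tq).
    by apply: ax => t /=; rewrite !in_itv/= => /andP[h1 h2]; apply/andP; split; lra.
  have pqJ t : p <= t -> b <= t -> t <= q -> J t.
    by move=> pt bt tq; apply: IJ => //; apply: pqI; rewrite /= in_itv/= pt.
  have [pb|bp] := leP p b.
    apply/abs_continuousE/abs_cont_norm_glue => //; first exact: ltW.
      apply/abs_continuousE/ax => t /=.
      by rewrite !in_itv/= => /andP[h1 h2]; apply/andP; split; lra.
    apply/abs_continuousE/ay => t /=; rewrite !in_itv/= => /andP[h1 h2].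
    by apply: pqJ => //; lra.
  apply: (@eq_abs_continuous _ _ y) => [t /andP[pt _]|].
    by rewrite leNgt (lt_le_trans bp pt).
  apply: ay => t /=; rewrite !in_itv/= => /andP[h1 h2].
  by apply: pqJ => //; lra.
have nb : {ae mu, forall t, t != b}.
  by apply: negligibleS (negligible1 b) => t /= /negP; rewrite negbK => /eqP.
apply: ae_imp2 (ae_imp2 (fun t h1 h2 => conj h1 h2) dx dy) nb => t [xt yt] tb It.
have [ltb|bt] := ltP t b.
  rewrite (ltW ltb); apply: (near_eq_is_derive _ (xt _)).
  - by near=> s; rewrite ifT//; apply: ltW; near: s; exact: lt_nbhsl.
  - by rewrite /= in_itv/= Ia//= ltW.
have {}bt : b < t by rewrite lt_neqAle eq_sym tb.
rewrite leNgt bt/=; apply: (near_eq_is_derive _ (yt _)).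
- by near=> s; rewrite leNgt ifF//; apply/negbF; near: s; exact: lt_nbhsr.
- by apply: IJ => //; exact: ltW.
Unshelve. all: by end_near. Qed.

Lemma ode_solution_continuous (a b : R) F x : ode_solution `[a, b] F x ->
  {within `[a, b], continuous x}.
Proof.
move=> [ax _]; have /abs_continuousE/abs_cont_norm_continuous xc := ax a b (@subset_refl _ _).
apply/within_continuousP => t; rewrite /= in_itv/= => tab e e0.
by have [d d0 dP] := xc t e tab e0; exists d.
Qed.

Lemma ode_solution_continuous_at (a b t : R) F x : ode_solution `[a, b] F x ->
  a < t < b -> {for t, continuous x}.
Proof.
move=> /ode_solution_continuous/subspace_continuousP xc /andP[at_ tb].
have /xc : `[a, b]%classic t by rewrite /= in_itv/= !ltW.
have it : (`[a, b]%classic)° t by rewrite interior_itv_bnd /= in_itv/= at_.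
by rewrite (within_interior it).
Qed.

Lemma ode_solution_increment (a b K : R) F G x y : a <= b -> 0 <= K ->
  ode_solution `[a, b] F x -> ode_solution `[a, b] G y ->
  (forall t, a <= t <= b -> `|F t (x t) - G t (y t)| <= K) ->
  `|(x b - y b) - (x a - y a)| <= K * (b - a).
Proof.
move=> ab K0 [ax dx] [ay dy] FGK.
have sab : `[a, b]%classic `<=` `[a, b]%classic by [].
apply: (@abs_cont_mean_value _ _ (fun t => x t - y t)) => //.
  by apply: abs_cont_normB; apply/abs_continuousE; [exact: ax|exact: ay].
apply: ae_imp2 dx dy => t xt yt tab; exists (F t (x t) - G t (y t)).
  by apply: is_deriveB; [apply: xt|apply: yt]; rewrite /= in_itv.
exact: FGK.
Qed.

End ode.

(** * Growth of the difference of two solutions *)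

Section growth.
Context {R : realType} {n : nat}.
Local Notation V := 'rV[R]_n.

(** The time is the supremum of those up to which [phi] stays below [c]. *)
Lemma first_hit (a b c : R) (phi : R -> R) : a <= b ->
  {within `[a, b], continuous phi} -> phi a < c -> c <= phi b ->
  exists2 t, a <= t <= b & phi t = c /\ forall s, a <= s <= t -> phi s <= c.
Proof.
move=> ab /within_continuousP phic pac cpb.
have near_t t (e : R) : a <= t <= b -> 0 < e -> exists2 d : R, 0 < d &
    forall s, a <= s <= b -> `|s - t| < d -> `|phi s - phi t| < e.
  by move=> tab e0; have := phic t; rewrite /= in_itv/= => /(_ tab e e0).
pose S := [set t | a <= t <= b /\ forall s, a <= s <= t -> phi s <= c].
have Sa : S a.
  split; first by rewrite lexx.
  by move=> s sa; rewrite (_ : s = a) ?ltW//; apply/eqP; rewrite eq_le andbC.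
have hS : has_sup S by split; [exists a|exists b => t [/andP[]]].
have supub := sup_upper_bound hS; pose t := sup S.
have at_ : a <= t by exact: supub.
have tb : t <= b by apply: ge_sup; [exists a|move=> s [/andP[]]].
have tab : a <= t <= b by rewrite at_.
have below s : a <= s -> s < t -> phi s <= c.
  move=> as_ st; have ts0 : 0 < t - s by lra.
  have [u [uab uP] su] := sup_adherent ts0 hS.
  by apply: uP; rewrite as_/= ltW//; move: (su); rewrite -/t; lra.
have tle : phi t <= c.
  rewrite leNgt; apply/negP => ct.
  have ct0 : 0 < phi t - c by lra.
  have [d d0 dP] := near_t t _ tab ct0.
  have ta : a < t by rewrite lt_neqAle at_ andbT; apply/eqP => ta; move: ct pac; rewrite -ta; lra.
  pose s := Num.max a (t - d / 2).
  have as_ : a <= s by rewrite /s le_max lexx.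
  have st : s < t by rewrite /s gt_max ta/=; lra.
  have ds : t - d / 2 <= s by rewrite /s le_max lexx orbT.
  have := below s as_ st; have := dP s.
  rewrite as_/= (le_trans (ltW st) tb) ltr0_norm; last by lra.
  have sd : - (s - t) < d by lra.
  by move=> /(_ isT sd); rewrite ltr_norml => /andP[]; lra.
exists t => //; split; last first.
  by move=> s /andP[as_]; rewrite le_eqVlt => /orP[/eqP->//|]; exact: below.
apply/eqP; rewrite eq_le tle leNgt; apply/negP => tc.
have tb' : t < b by rewrite lt_neqAle tb andbT; apply/eqP => tb'; move: tc cpb; rewrite tb'; lra.
have ct0 : 0 < c - phi t by lra.
have [d d0 dP] := near_t t _ tab ct0.
pose v := Num.min b (t + d / 2).
have vb : v <= b by rewrite /v ge_min lexx.
have tv : t < v by rewrite /v lt_min tb'/=; lra.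
have vd : v <= t + d / 2 by rewrite /v ge_min lexx orbT.
have : v <= t.
  apply: supub; split; first by rewrite vb andbT; lra.
  move=> s /andP[as_ sv]; have [st|ts] := ltP s t; first exact: below.
  have := dP s; rewrite as_/= (le_trans sv vb) ger0_norm ?subr_ge0//.
  have sd : s - t < d by lra.
  by move=> /(_ isT sd); rewrite ltr_norml => /andP[]; lra.
by rewrite leNgt tv.
Qed.

Lemma interval_split (L a b : R) (N : nat) : 0 < L -> a <= b ->
  L * (b - a) <= N.+1%:R / 4 ->
  exists c, [/\ a <= c <= b, L * (c - a) <= N%:R / 4 & L * (b - c) <= 4^-1].
Proof.
move=> L0 ab Lab; pose c := a + (b - a) * (N%:R / N.+1%:R).
have NN1 : N%:R / N.+1%:R <= 1 :> R by rewrite ler_pdivrMr// mul1r ler_nat.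
have bcE : b - c = (b - a) / N.+1%:R.
  by rewrite /c -natr1; field; rewrite natr1 gt_eqF.
exists c; split.
- by rewrite lerDl mulr_ge0 ?subr_ge0// ?divr_ge0//= -subr_ge0 bcE divr_ge0// subr_ge0.
- have -> : L * (c - a) = L * (b - a) * (N%:R / N.+1%:R).
    by rewrite /c [a + _]addrC addrK mulrA.
  apply: (@le_trans _ _ (N.+1%:R / 4 * (N%:R / N.+1%:R))).
    by rewrite ler_wpM2r// divr_ge0.
  by rewrite mulrAC mulrCA mulfV ?gt_eqF// mulr1.
- rewrite bcE mulrA ler_pdivrMr//; apply: le_trans Lab _.
  by rewrite mulrC.
Qed.

Section comparison.
Context (F G : R -> V -> V) (x y : R -> V) (L nu : R).
Hypotheses (L0 : 0 < L) (nu0 : 0 <= nu).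

(** The Lipschitz bound [FG] is local, so the difference of the solutions must
    first be kept below 1; the factors leave room for that on short intervals. *)
Lemma short_growth (a b : R) : a <= b ->
  ode_solution `[a, b] F x -> ode_solution `[a, b] G y ->
  (forall t, a <= t <= b -> `|x t - y t| <= 1 ->
     `|F t (x t) - G t (y t)| <= L * (`|x t - y t| + nu)) ->
  L * (b - a) <= 4^-1 -> `|x a - y a| <= 4^-1 -> nu <= 4^-1 ->
  (forall t, a <= t <= b -> `|x t - y t| <= 2 * `|x a - y a| + nu) /\
  `|(x b - y b) - (x a - y a)| <= (`|x a - y a| + nu) / 2.
Proof.
move=> ab xs ys FG Lab ea nu1.
pose e (t : R) : V := x t - y t.
have ec : {within `[a, b], continuous (fun t => `|e t|)}.
  move=> t; apply: continuous_comp; last exact: norm_continuous.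
  apply: (@continuousB R V (subspace `[a, b]%classic) x y t).
    exact: (ode_solution_continuous xs).
  exact: (ode_solution_continuous ys).
have incr (t K : R) : a <= t <= b -> 0 <= K ->
    (forall s, a <= s <= t -> `|e s| <= K /\ `|e s| <= 1) ->
    `|e t - e a| <= 4^-1 * (K + nu).
  move=> /andP[at_ tb] K0 eK.
  have sub : `[a, t]%classic `<=` `[a, b]%classic.
    by move=> s /=; rewrite !in_itv/= => /andP[-> /le_trans ->].
  have LK : 0 <= L * (K + nu) by apply: mulr_ge0; [exact: ltW|exact: addr_ge0].
  have /(_ _)/le_trans-> // := ode_solution_increment at_ LK
    (ode_solutionS sub xs) (ode_solutionS sub ys) _.
    move=> s /andP[as_ st]; have [e1 e2] := eK s (introT andP (conj as_ st)).
    apply: le_trans (FG s _ e2) _; first by rewrite as_ (le_trans st).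
    by apply: ler_wpM2l; [exact: ltW|lra].
  rewrite mulrAC ler_wpM2r ?addr_ge0//; apply: le_trans Lab.
  by apply: ler_wpM2l; [exact: ltW|lra].
have e1 t : a <= t <= b -> `|e t| < 1.
  move=> /andP[at_ tb]; rewrite ltNge; apply/negP => et.
  have sub : `[a, t]%classic `<=` `[a, b]%classic.
    by move=> s /=; rewrite !in_itv/= => /andP[-> /le_trans ->].
  have ea1 : `|e a| < 1 by apply: le_lt_trans ea _; lra.
  have [s /andP[as_ st] [es1 eS]] := first_hit at_ (continuous_subspaceW sub ec) ea1 et.
  have := incr s 1; rewrite as_ (le_trans st tb) => /(_ isT ler01) => H.
  have {}H : `|e s - e a| <= 4^-1 * (1 + nu) by apply: H => r rs; split; exact: eS.
  have : `|e s| <= `|e s - e a| + `|e a| by rewrite -{1}(subrK (e a) (e s)) ler_normD.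
  by move: ea; rewrite -/(e a) es1; lra.
have [c cab cmax] := EVT_max ab ec.
have {}cab : a <= c <= b by move: cab; rewrite in_itv.
have cmax' t : a <= t <= b -> `|e t| <= `|e c| by move=> tab; apply: cmax; rewrite in_itv.
have cS : `|e c| <= `|e c - e a| + `|e a|.
  by rewrite -{1}(subrK (e a) (e c)) ler_normD.
have H1 : `|e c - e a| <= 4^-1 * (`|e c| + nu).
  apply: incr => // s /andP[as_ sc]; have sab : a <= s <= b.
    by rewrite as_; case/andP: cab => _; exact: le_trans.
  by split; [exact: cmax'|exact/ltW/e1].
have H2 : `|e b - e a| <= 4^-1 * (`|e c| + nu).
  apply: incr => //; first by rewrite ab lexx.
  by move=> s sab; split; [exact: cmax'|exact/ltW/e1].
have T : `|e c| <= 4^-1 * (`|e c| + nu) + `|e a|.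
  exact: (le_trans cS (lerD H1 (lexx _))).
have ea0 := normr_ge0 (e a).
have eaE : `|x a - y a| = `|e a| by [].
rewrite eaE; split=> [t tab|].
  have cm : `|x t - y t| <= `|e c| := cmax' t tab.
  by apply: le_trans cm _; move: T ea0 nu0; move: (`|e c|) (`|e a|) => p q; lra.
apply: le_trans H2 _.
by move: T ea0 nu0; move: (`|e c|) (`|e a|) => p q; lra.
Qed.

(** Gronwall-type estimate, by induction on a number of intervals of length at most
    [1 / (4 L)]: splitting off the last one costs a factor 4, which replaces the
    exponential. The parameter [nu] bounds the difference of the inputs. *)
Lemma growth (N : nat) (a b : R) : a <= b ->
  ode_solution `[a, b] F x -> ode_solution `[a, b] G y ->
  (forall t, a <= t <= b -> `|x t - y t| <= 1 ->
     `|F t (x t) - G t (y t)| <= L * (`|x t - y t| + nu)) ->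
  L * (b - a) <= N%:R / 4 -> 4 ^+ N * (`|x a - y a| + nu) <= 4^-1 ->
  forall t, a <= t <= b -> `|x t - y t| <= 4 ^+ N * (`|x a - y a| + nu).
Proof.
elim: N b => [|N IH] b ab xs ys FG Lab ea t /andP[at_ tb].
  have : b - a <= 0 by move: Lab; rewrite mul0r pmulr_rle0.
  move=> ba; have -> : t = a by lra.
  by rewrite expr0 mul1r lerDl.
have [c [/andP[ac cb] Lac Lcb]] := interval_split L0 ab Lab.
have suba : `[a, c]%classic `<=` `[a, b]%classic.
  by move=> s /=; rewrite !in_itv/= => /andP[-> /le_trans ->].
have subb : `[c, b]%classic `<=` `[a, b]%classic.
  by move=> s /=; rewrite !in_itv/= => /andP[h1 h2]; rewrite h2 andbT; lra.
have E0 : 0 <= `|x a - y a| + nu by rewrite addr_ge0.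
have P0 : 0 <= 4 ^+ N * (`|x a - y a| + nu) by rewrite mulr_ge0// exprn_ge0.
have P1 : 1 <= 4 ^+ N :> R by rewrite exprn_ege1//; lra.
have nuP : nu <= 4 ^+ N * (`|x a - y a| + nu).
  apply: (@le_trans _ _ (1 * (`|x a - y a| + nu))); last by rewrite ler_wpM2r.
  by rewrite mul1r lerDr.
rewrite exprS -mulrA in ea *.
have {}IH := IH c ac (ode_solutionS suba xs) (ode_solutionS suba ys).
have {IH}ac' : forall t, a <= t <= c -> `|x t - y t| <= 4 ^+ N * (`|x a - y a| + nu).
  apply: IH => //; last by lra.
  by move=> s /andP[h1 h2]; apply: FG; rewrite h1 (le_trans h2).
have [tc|ct] := leP t c.
  by apply: le_trans (ac' t _) _; [rewrite at_|lra].
have ec := ac' c; rewrite ac lexx in ec.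
have [] := short_growth cb (ode_solutionS subb xs) (ode_solutionS subb ys) _ Lcb.
- by move=> s /andP[h1 h2]; apply: FG; rewrite h2 andbT; lra.
- by apply: le_trans (ec isT) _; lra.
- by lra.
move=> /(_ t); rewrite (ltW ct) tb => /(_ isT) h _.
by apply: le_trans h _; have := ec isT; lra.
Qed.

End comparison.
End growth.

(** * Trajectories of a control system *)

Section boundedness.
Context {R : realType}.

Lemma bounded_onP (V : normedModType R) (A : set R) (u : R -> V) :
  [bounded u t | t in A] <-> exists M : R, forall t, A t -> `|u t| <= M.
Proof.
split=> [[M [Mr MP]]|[M MP]].
  by exists (M + 1) => t At; apply: (MP (M + 1)) => //; rewrite ltrDl.
by exists M; split; [exact: num_real|move=> x Mx t At; apply: le_trans (MP t At) (ltW Mx)].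
Qed.

Lemma continuous_bounded (V : normedModType R) (a b : R) (x : R -> V) :
  {within `[a, b], continuous x} ->
  exists2 M : R, 0 <= M & forall t, a <= t <= b -> `|x t| <= M.
Proof.
move=> xc; have [ab|ba] := leP a b; last first.
  by exists 0 => // t /andP[at_ tb]; lra.
have nc : {within `[a, b], continuous (fun t => `|x t|)}.
  by move=> t; apply: continuous_comp; [exact: xc|exact: norm_continuous].
have [c cab cmax] := EVT_max ab nc; by exists `|x c|.
Qed.

Lemma compact_ball (n : nat) (r : R) : compact [set v : 'rV[R]_n | `|v| <= r].
Proof.
apply: bounded_closed_compact.
  by exists r; split; [exact: num_real|move=> M rM v /= /le_trans; apply; exact: ltW].
have -> : [set v : 'rV[R]_n | `|v| <= r] = (fun v : 'rV[R]_n => `|v|) @^-1` `]-oo, r].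
  by apply/seteqP; split => v /=; rewrite in_itv.
apply: preimage_closed; last exact: interval_closed.
by move=> v _; exact: norm_continuous.
Qed.

(** The local Lipschitz condition is imposed near every pair of points,
    distinct or not, so compactness of the product of the ball with itself
    gives one constant at once. *)
Lemma lipschitz_on_ball (n m p : nat) (f : 'rV[R]_n -> 'rV[R]_m -> 'rV[R]_p) :
  locally_lipschitz f -> forall r : R, exists2 L : R, 0 < L &
  forall x y u v, `|x| <= r -> `|y| <= r -> `|u| <= r -> `|v| <= r ->
    `|f x u - f y v| <= L * (`|x - y| + `|u - v|).
Proof.
move=> flip r.
pose K := [set v : 'rV[R]_n | `|v| <= r] `*` [set v : 'rV[R]_m | `|v| <= r].
have cK : compact (K `*` K) by do !apply: compact_setX; exact: compact_ball.
pose P (L : R) (w : ('rV[R]_n * 'rV[R]_m) * ('rV[R]_n * 'rV[R]_m)) :=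
  `|f w.1.1 w.1.2 - f w.2.1 w.2.2| <= L * `|w.1 - w.2|.
have /compact_near_coveringP/(_ R (+oo)%R P) := cK.
move=> /(_ _)[].
  move=> w _; have [M [Mr MP]] := flip w (conj Logic.I Logic.I).
  have := MP (M + 1); rewrite ltrDl => /(_ ltr01) wP.
  exists ([set w' | P (M + 1) w'], [set L | M + 1 < L]) => /=.
    split; last by exists (M + 1); split => //; exact: num_real.
    have wP' : nbhs w (fun w' => (setT `*` setT) w' -> P (M + 1) w') := wP.
    by apply: filterS wP' => w' /=; apply; split.
  move=> [w' L] [/= Pw' ML]; apply: le_trans Pw' _.
  by rewrite ler_wpM2r// ltW.
move=> M [Mr MP]; pose L := Num.max 1 (M + 1).
have L0 : 0 < L by rewrite /L lt_max ltr01.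
exists L => // x y u v xr yr ur vr.
have ML : M < L by rewrite /L lt_max ltrDl ltr01 orbT.
have := MP L ML ((x, u), (y, v)) => /(_ (conj (conj xr ur) (conj yr vr))) /le_trans; apply.
apply: ler_wpM2l; first exact: ltW.
rewrite [leLHS]prod_normE /= ge_max.
by apply/andP; split; [rewrite lerDl|rewrite lerDr].
Qed.

End boundedness.

Section flow.
Context {R : realType} {n m : nat} (f : 'rV[R]_n -> 'rV[R]_m -> 'rV[R]_n).
Local Notation V := 'rV[R]_n.
Local Notation U := 'rV[R]_m.
Local Notation traj I u := (ode_solution I (fun t y => f y (u t))).
Implicit Types (u v : R -> U) (x y : R -> V).

Definition admissible (a b M : R) u : Prop :=
  lebesgue_measurable_fun `[a, b] u /\ forall t, a <= t <= b -> `|u t| <= M.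

Lemma admissibleS (a b a' b' M : R) u : a <= a' -> b' <= b ->
  admissible a b M u -> admissible a' b' M u.
Proof.
move=> aa bb [mu_ uM]; split; last first.
  by move=> t /andP[h1 h2]; apply: uM; rewrite (le_trans aa)//= (le_trans h2).
apply: lebesgue_measurable_funS (lebesgue_measurable_itv _) _ mu_.
by move=> t /=; rewrite !in_itv/= => /andP[h1 h2]; rewrite (le_trans aa)//= (le_trans h2).
Qed.

(** The system is autonomous, so the initial time can be shifted to 0. *)
Lemma traj_exists_infty (a : R) u (p : V) : forward_complete f ->
  Linfty_loc `[a, +oo[ u -> exists x, traj `[a, +oo[ u x /\ x a = p.
Proof.
move=> fc [mu_ bu].
have sh : [set t | `[a, +oo[%classic (t + a)] = `[0, +oo[%classic :> set R.
  by apply/seteqP; split => t /=; rewrite !in_itv/= !andbT; lra.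
have [|x [xs x0]] := fc p (fun t => u (t + a)).
  split; first by rewrite -sh; exact: lebesgue_measurable_fun_shift.
  move=> c d cd; have [M MP] : exists M : R, forall t, `[c + a, d + a]%classic t -> `|u t| <= M.
    apply/bounded_onP/bu => t /=; rewrite !in_itv/= andbT => /andP[h1 h2].
    have : `[c, d]%classic (t - a) by rewrite /= in_itv/=; apply/andP; split; lra.
    by move=> /cd; rewrite /= in_itv/= andbT; lra.
  apply/bounded_onP; exists M => t /=; rewrite in_itv/= => td.
  by apply: MP; rewrite /= in_itv/=; lra.
exists (fun t => x (t - a)); split; last by rewrite subrr.
have := ode_solution_shift (- a) xs.
have -> : [set t | `[0, +oo[%classic (t - a)] = `[a, +oo[%classic :> set R.
  by apply/seteqP; split => t /=; rewrite !in_itv/= !andbT; lra.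
by apply: eq_ode_rhs (negligible_set0 _) _ => t _ _; rewrite subrK.
Qed.

(** The control is extended by 0 beyond the interval. *)
Lemma traj_exists (a b M : R) u (p : V) : forward_complete f ->
  admissible a b M u -> exists x, traj `[a, b] u x /\ x a = p.
Proof.
move=> fc [mu_ bu]; pose v t := if t <= b then u t else 0.
have [|x [xs xa]] := @traj_exists_infty a v p fc.
  split.
    have -> : `[a, +oo[%classic = (`[a, b] `|` (`[a, +oo[ `&` `]b, +oo[))%classic :> set R.
      apply/seteqP; split => t /=; rewrite !in_itv/= ?andbT.
        by move=> ->; have [?|?] := leP t b; [left|right; split].
      by move=> [/andP[]|[]].
    apply: lebesgue_measurable_funU.
    - exact: lebesgue_measurable_itv.
    - by apply: measurableI; exact: lebesgue_measurable_itv.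
    - apply: eq_lebesgue_measurable_fun mu_ => t.
      by rewrite /= in_itv/= /v => /andP[_ ->].
    - apply: (@eq_lebesgue_measurable_fun _ _ _ (fun=> 0)).
        by move=> t /= [_]; rewrite in_itv/= andbT /v leNgt => ->.
      exact: lebesgue_measurable_fun_cst.
  move=> c d cd; apply/bounded_onP; exists (Num.max 0 M) => t tcd.
  have /cd : `[c, d]%classic t by [].
  rewrite /= in_itv/= andbT /v => at_; case: ifP => tb; last first.
    by rewrite normr0 le_max lexx.
  by rewrite le_max bu ?orbT// at_.
exists x; split=> //; apply: eq_ode_rhs (negligible_set0 _) _ (ode_solutionS _ xs).
  by move=> t; rewrite /= in_itv/= /v => /andP[_ ->].
by move=> t; rewrite /= !in_itv/= => /andP[->].
Qed.

Hypothesis f_lip : locally_lipschitz f.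

(** [growth] with zero initial difference and equal inputs; the two trajectories
    are compact, which provides the Lipschitz constant. *)
Lemma traj_unique (a b M : R) u x y :
  (forall t, a <= t <= b -> `|u t| <= M) ->
  traj `[a, b] u x -> traj `[a, b] u y -> x a = y a ->
  forall t, a <= t <= b -> x t = y t.
Proof.
move=> uM xs ys xya t tab.
have ab : a <= b by case/andP: tab => /le_trans h /h.
have [X X0 xX] := continuous_bounded (ode_solution_continuous xs).
have [Y Y0 yY] := continuous_bounded (ode_solution_continuous ys).
have [L L0 LP] := lipschitz_on_ball f_lip (Num.max M (Num.max X Y)).
have := @growth _ _ _ _ x y L 0 L0 (lexx 0) (Num.truncn (4 * L * (b - a))).+1 a b ab xs ys.
move=> /(_ _ _ _ t tab); rewrite xya subrr normr0 addr0 mulr0 normr_le0 subr_eq0.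
move=> H; apply/eqP; apply: H.
- move=> s sab _; have := LP (x s) (y s) (u s) (u s).
  by rewrite subrr normr0; apply; rewrite !le_max ?uM ?xX ?yY ?orbT.
- have := truncnS_gt (4 * L * (b - a)); lra.
- by rewrite invr_ge0.
Qed.

End flow.

(** * Backward trajectories *)

HB.instance Definition _ (R : realType) (n : nat) := Complete.on 'rV[R]_n.

Section backward.
Context {R : realType} {n m : nat} (f : 'rV[R]_n -> 'rV[R]_m -> 'rV[R]_n).
Local Notation V := 'rV[R]_n.
Local Notation U := 'rV[R]_m.
Local Notation traj I u := (ode_solution I (fun t y => f y (u t))).
Hypotheses (f_lip : locally_lipschitz f) (f_fc : forward_complete f).
Context (rho M L : R) (L0 : 0 < L).
Hypothesis f_L : forall x y u, `|x| <= rho + 1 -> `|y| <= rho + 1 -> `|u| <= M ->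
  `|f x u - f y u| <= L * `|x - y|.

Let traj_lip (a b : R) (u : R -> U) (x x' : R -> V) :
  (forall t, a <= t <= b -> `|u t| <= M) ->
  (forall t, a <= t <= b -> `|x t| <= rho) ->
  forall t, a <= t <= b -> `|x' t - x t| <= 1 ->
   `|f (x' t) (u t) - f (x t) (u t)| <= L * (`|x' t - x t| + 0).
Proof.
move=> uM xr t tab x1; rewrite addr0; apply: f_L; rewrite ?uM//.
  rewrite -(subrK (x t) (x' t)) (le_trans (ler_normD _ _))// addrC lerD// xr//.
by rewrite (le_trans (xr t tab))// lerDl.
Qed.

(** The end points of trajectories issued from nearby points differ from the
    starting points by a contraction, so the shooting equation is solved by a
    fixed point: forward completeness yields backward trajectories. *)
Lemma short_backward (a b eta : R) (u : R -> U) (x : R -> V) (q : V) :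
  a <= b -> L * (b - a) <= 4^-1 -> admissible a b M u ->
  traj `[a, b] u x -> (forall t, a <= t <= b -> `|x t| <= rho) ->
  0 < eta -> eta <= 16^-1 -> `|q - x b| <= eta ->
  exists x', [/\ traj `[a, b] u x', x' b = q & `|x' a - x a| <= 2 * eta].
Proof.
move=> ab Lab uM xs xr eta0 eta1 qx.
have [phi phiP] := choice (fun p => traj_exists p f_fc uM).
pose B : set V := [set p | `|p - x a| <= 2 * eta].
have Bx p : B p -> (forall t, a <= t <= b -> `|phi p t - x t| <= 4 * eta) /\
    `|(phi p b - x b) - (p - x a)| <= eta.
  move=> Bp; have [ps pa] := phiP p.
  have := short_growth L0 (lexx 0) ab ps xs (traj_lip uM.2 xr) Lab.
  rewrite pa !addr0 => -[||h1 h2]; [rewrite /B/= in Bp; lra|by rewrite invr_ge0|].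
  rewrite /B/= in Bp; split=> [t /h1|].
    by move=> h; apply: le_trans h _; lra.
  by apply: le_trans h2 _; lra.
have phir p : B p -> forall t, a <= t <= b -> `|phi p t| <= rho + 1.
  move=> /Bx[h _] t tab; rewrite -(subrK (x t) (phi p t)).
  apply: le_trans (ler_normD _ _) _; rewrite addrC lerD ?xr//.
  by apply: le_trans (h t tab) _; lra.
pose T p := p + q - phi p b.
have BT p : B p -> B (T p).
  move=> Bp; have [_ h] := Bx p Bp; rewrite /B/= /T.
  have -> : p + q - phi p b - x a = (q - x b) - ((phi p b - x b) - (p - x a)).
    by rewrite !opprD !opprK; apply/rowP => i; rewrite !mxE; lra.
  by apply: le_trans (ler_normB _ _) _; lra.
have contr p p' : B p -> B p' -> `|T p - T p'| <= 2^-1 * `|p - p'|.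
  move=> Bp Bp'; have [ps pa] := phiP p; have [ps' pa'] := phiP p'.
  have pp' : `|p - p'| <= 4^-1.
    have -> : p - p' = (p - x a) - (p' - x a) by rewrite opprB subrKA.
    apply: le_trans (ler_normB _ _) _; rewrite /B/= in Bp Bp'; lra.
  have := @short_growth _ _ _ _ (phi p) (phi p') L 0 L0 (lexx 0) a b ab ps ps'.
  rewrite pa pa' !addr0 => -[|//|//||_ h].
  - move=> t tab _; rewrite addr0; apply: f_L; [exact: phir|exact: phir|exact: uM.2].
  - by rewrite invr_ge0.
  - have -> : T p - T p' = - ((phi p b - phi p' b) - (p - p')).
      by apply/rowP => i; rewrite !mxE; lra.
    by rewrite normrN mulrC.
have clB : closed B.
  have -> : B = (fun p : V => `|p - x a|) @^-1` `]-oo, 2 * eta].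
    by apply/seteqP; split => p /=; rewrite in_itv.
  apply: preimage_closed; last exact: interval_closed.
  move=> p _; apply: continuous_comp; last exact: norm_continuous.
  by apply: continuousB; [exact: id|exact: cst_continuous].
have B0 : B !=set0 by exists (x a); rewrite /B/= subrr normr0 mulr_ge0// ltW.
have [|p Bp pT] := @banach_fixed_point R V B (mkfun_fun BT) _ clB B0.
  exists (2^-1)%:nng; split; first by rewrite /= invf_lt1// ltr1n.
  by move=> [p p'] [/= Bp Bp']; exact: contr.
have [ps pa] := phiP p; exists (phi p); split => //; last by rewrite pa.
have pT' : p = p + q - phi p b := pT.
by apply/rowP => i; move/rowP: pT' => /(_ i); rewrite !mxE; lra.
Qed.

(** Backward steps over short intervals are composed; each of them doubles the
    radius in which the initial state must be looked for. *)
Lemma backward (N : nat) (a b eta : R) (u : R -> U) (x : R -> V) (q : V) :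
  a <= b -> L * (b - a) <= N%:R / 4 -> admissible a b M u ->
  traj `[a, b] u x -> (forall t, a <= t <= b -> `|x t| <= rho) ->
  0 < eta -> 2 ^+ N * eta <= 16^-1 -> `|q - x b| <= eta ->
  exists x', [/\ traj `[a, b] u x', x' b = q & `|x' a - x a| <= 2 ^+ N * eta].
Proof.
elim: N b eta q => [|N IH] b eta q ab Lab uM xs xr eta0 eta1 qx.
  have ba : b = a.
    by move: Lab; rewrite mul0r pmulr_rle0//; lra.
  have [x' [x's x'a]] := traj_exists q f_fc uM.
  by exists x'; rewrite expr0 mul1r {2}ba; split => //; rewrite x'a -ba.
have [c [/andP[ac cb] Lac Lcb]] := interval_split L0 ab Lab.
have suba : `[a, c]%classic `<=` `[a, b]%classic.
  by move=> s /=; rewrite !in_itv/= => /andP[-> /le_trans ->].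
have subb : `[c, b]%classic `<=` `[a, b]%classic.
  by move=> s /=; rewrite !in_itv/= => /andP[h1 h2]; rewrite h2 andbT; lra.
have N1 : 1 <= 2 ^+ N :> R by rewrite exprn_ege1//; lra.
have eta2 : 2 ^+ N * (2 * eta) <= 16^-1 by move: eta1; rewrite exprS mulrCA mulrA.
have eta3 : eta <= 16^-1.
  apply: le_trans eta2; rewrite mulrA ler_peMl//; last by lra.
  exact: ltW.
have [|x2 [x2s x2b x2c]] := short_backward cb Lcb (admissibleS ac (lexx _) uM)
    (ode_solutionS subb xs) _ eta0 eta3 qx.
  by move=> t /andP[h1 h2]; apply: xr; rewrite h2 andbT; lra.
have [||x1 [x1s x1c x1a]] := IH c (2 * eta) (x2 c) ac Lac (admissibleS (lexx _) cb uM)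
    (ode_solutionS suba xs) _ _ eta2 x2c.
- by move=> t /andP[h1 h2]; apply: xr; rewrite h1/= (le_trans h2).
- by rewrite mulr_gt0.
exists (fun t => if t <= c then x1 t else x2 t); split.
- apply: ode_solution_glue x1c x1s x2s.
    by move=> t /=; rewrite in_itv/= => /andP[].
  by move=> t /=; rewrite !in_itv/= => /andP[_ ->] ->.
- case: ifPn => // bc; rewrite -x2b; have -> : b = c by apply/eqP; rewrite eq_le cb bc.
  exact: x1c.
- by rewrite ac; apply: le_trans x1a _; rewrite exprS mulrCA mulrA.
Qed.

End backward.

(** * Bounded reachability *)

Section reachability.
Context {R : realType} {n m : nat} (f : 'rV[R]_n -> 'rV[R]_m -> 'rV[R]_n).
Local Notation V := 'rV[R]_n.
Local Notation U := 'rV[R]_m.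
Local Notation traj I u := (ode_solution I (fun t y => f y (u t))).
Implicit Types (u v : R -> U) (x : R -> V).

Lemma admissible_shift (a b c M : R) u : admissible (a + c) (b + c) M u ->
  admissible a b M (fun t => u (t + c)).
Proof.
move=> [mu_ uM]; split; last by move=> t tab; apply: uM; rewrite !lerD2r.
have := lebesgue_measurable_fun_shift (c := c) mu_.
congr (lebesgue_measurable_fun _ _).
by apply/seteqP; split => t /=; rewrite !in_itv/= !lerD2r.
Qed.

Lemma traj_shift (a b c : R) u x : traj `[a + c, b + c] u x ->
  traj `[a, b] (fun t => u (t + c)) (fun t => x (t + c)).
Proof.
move=> /(ode_solution_shift c); congr (ode_solution _ _ _).
by apply/seteqP; split => t /=; rewrite !in_itv/= !lerD2r.
Qed.

Lemma admissible_glue (a b c M : R) u v : a <= b -> b <= c ->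
  admissible a b M u -> admissible b c M v ->
  admissible a c M (fun t => if t < b then u t else v t).
Proof.
move=> ab bc [mu_ uM] [mv vM]; split; last first.
  move=> t /andP[at_ tc]; have [tb|bt] := ltP t b.
    by apply: uM; rewrite at_ ltW.
  by apply: vM; rewrite bt.
have -> : `[a, c]%classic = (`[a, b[ `|` `[b, c])%classic :> set R.
  apply/seteqP; split => t /=; rewrite !in_itv/=.
    by move=> /andP[at_ tc]; have [tb|bt] := ltP t b; [left|right]; rewrite ?at_ ?tc.
  by move=> [/andP[h1 h2]|/andP[h1 h2]]; apply/andP; split; lra.
apply: lebesgue_measurable_funU.
- exact: lebesgue_measurable_itv.
- exact: lebesgue_measurable_itv.
- apply: (@eq_lebesgue_measurable_fun _ _ _ u).
    by move=> t /=; rewrite in_itv/= => /andP[_ ->].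
  apply: lebesgue_measurable_funS (lebesgue_measurable_itv _) _ mu_.
  by move=> t /=; rewrite !in_itv/= => /andP[-> /ltW].
- apply: (@eq_lebesgue_measurable_fun _ _ _ v) mv.
  by move=> t /=; rewrite in_itv/= ltNge => /andP[-> _].
Qed.

Lemma traj_glue (a b c : R) u v x y : a <= b -> b <= c -> x b = y b ->
  traj `[a, b] u x -> traj `[b, c] v y ->
  traj `[a, c] (fun t => if t < b then u t else v t)
    (fun t => if t <= b then x t else y t).
Proof.
move=> ab bc xyb xs ys; apply: (@ode_solution_glue _ _ _ `[b, c] _ _ _ a) => //.
- by move=> t /=; rewrite in_itv/= => /andP[].
- by move=> t /=; rewrite !in_itv/= => /andP[_ ->] ->.
- apply: eq_ode_rhs (negligible1 b) _ xs => t /=.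
  rewrite in_itv/= => /andP[_]; rewrite le_eqVlt => /orP[/eqP //|-> //].
- apply: eq_ode_rhs (negligible_set0 _) _ ys => t /=.
  by rewrite in_itv/= ltNge => /andP[-> _].
Qed.

Hypotheses (f_lip : locally_lipschitz f) (f_fc : forward_complete f).

Lemma lipschitz_state (rho M : R) : exists2 L : R, 0 < L &
  forall (x y : V) (u : U), `|x| <= rho + 1 -> `|y| <= rho + 1 -> `|u| <= M ->
    `|f x u - f y u| <= L * `|x - y|.
Proof.
have [L L0 LP] := lipschitz_on_ball f_lip (Num.max (rho + 1) M).
exists L => // x y u xr yr uM; have := LP x y u u.
by rewrite subrr normr0 addr0; apply; rewrite le_max ?xr ?yr ?uM ?orbT.
Qed.

(** Enough intervals of length [1 / (4 L)] to cover a duration [T]. *)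
Let steps (L T : R) := (Num.truncn (4 * L * T)).+1.

Let stepsP (L T s : R) : 0 < L -> s <= T -> L * s <= (steps L T)%:R / 4.
Proof.
move=> L0 sT; have := truncnS_gt (4 * L * T); rewrite -/(steps L T).
have : L * s <= L * T by rewrite ler_pM2l.
by lra.
Qed.

Lemma traj_forward_continuity (a b M d : R) u x : a <= b ->
  (forall t, a <= t <= b -> `|u t| <= M) -> traj `[a, b] u x -> 0 < d ->
  exists2 e : R, 0 < e & forall x', traj `[a, b] u x' -> `|x' a - x a| <= e ->
    `|x' b - x b| <= d.
Proof.
move=> ab uM xs d0.
have [rho rho0 xr] := continuous_bounded (ode_solution_continuous xs).
have [L L0 LP] := lipschitz_state rho M.
pose N := steps L (b - a).
pose e := Num.min d 4^-1 / 4 ^+ N.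
have N0 : 0 < 4 ^+ N :> R by rewrite exprn_gt0.
exists e => [|x' x's xe].
  by rewrite divr_gt0// lt_min d0/= invr_gt0.
have em : 4 ^+ N * `|x' a - x a| <= Num.min d 4^-1.
  by rewrite mulrC -ler_pdivlMr.
have := @growth _ _ _ _ x' x L 0 L0 (lexx 0) N a b ab x's xs.
move=> /(_ _ _ _ b); rewrite !addr0 ab lexx => H.
apply: le_trans (H _ _ _ isT) _.
- move=> t tab x1; rewrite addr0; apply: LP; rewrite ?uM//.
    rewrite -(subrK (x t) (x' t)) (le_trans (ler_normD _ _))// addrC lerD// xr//.
  by rewrite (le_trans (xr t tab))// lerDl.
- exact: stepsP.
- by apply: le_trans em _; rewrite ge_min lexx orbT.
- by apply: le_trans em _; rewrite ge_min lexx.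
Qed.

(** The radius of the target ball is uniform over the trajectories of a given
    size and duration. *)
Lemma traj_backward (rho M T e : R) : 0 < e -> exists2 d : R, 0 < d &
  forall a b u x q, a <= b -> b - a <= T -> admissible a b M u ->
    traj `[a, b] u x -> (forall t, a <= t <= b -> `|x t| <= rho) ->
    `|q - x b| <= d ->
  exists x', [/\ traj `[a, b] u x', x' b = q & `|x' a - x a| <= e].
Proof.
move=> e0; have [L L0 LP] := lipschitz_state rho M.
pose N := steps L T.
have N0 : 0 < 2 ^+ N :> R by rewrite exprn_gt0.
pose d := Num.min e 16^-1 / 2 ^+ N.
have d0 : 0 < d by rewrite divr_gt0// lt_min e0/= invr_gt0.
have Nd : 2 ^+ N * d = Num.min e 16^-1 by rewrite mulrC divfK// gt_eqF.
exists d => // a b u x q ab bT uM xs xr qx.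
have [|x' [x's x'b x'a]] := backward f_fc L0 LP ab (stepsP L0 bT) uM xs xr d0 _ qx.
  by rewrite Nd ge_min lexx orbT.
by exists x'; split => //; apply: le_trans x'a _; rewrite Nd ge_min lexx.
Qed.

(** A point is explosive if trajectories of admissible controls issued from
    arbitrarily near it become arbitrarily large within (about) time [th].
    Nearness instead of equality makes the notion stable under limits. *)
Definition explosive (M : R) (y : V) (th : R) : Prop :=
  forall C d : R, 0 < d -> exists s u x,
    [/\ 0 <= s <= th + d, admissible 0 s M u, traj `[0, s] u x,
        `|x 0 - y| < d & C < `|x s|].

Lemma explosive_ge0 M y th : explosive M y th -> 0 <= th.
Proof.
move=> ex; apply/ler_addgt0Pr => d d0.
by have [s [u [x [/andP[s0 sd] _ _ _ _]]]] := ex 0 d d0; exact: le_trans sd.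
Qed.

(** If no point of the ball were explosive, each would have a neighbourhood with a
    bound on the states reached, and compactness would give one for the ball. *)
Lemma explosive_exists (r M T : R) :
  ~ (exists C : R, forall s u x, 0 <= s <= T -> admissible 0 s M u ->
       traj `[0, s] u x -> `|x 0| <= r -> `|x s| <= C) ->
  exists y, explosive M y T.
Proof.
move=> nb; apply: contrapT => nex; apply: nb.
pose P (C : R) (y : V) := forall s u x, 0 <= s <= T -> admissible 0 s M u ->
  traj `[0, s] u x -> x 0 = y -> `|x s| <= C.
have /compact_near_coveringP/(_ R (+oo)%R P) := @compact_ball R n r.
move=> /(_ _)[].
  move=> y _; have /existsNP[C /existsNP[d /not_implyP[d0 nd]]] :
    ~ explosive M y T by move=> ey; apply: nex; exists y.
  exists ([set y' | `|y' - y| < d], [set C' | C < C']) => /=.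
    split; last by exists C; split => //; exact: num_real.
    by apply/nbhs_ballP; exists d => //= y'; rewrite -ball_normE /= distrC.
  move=> [y' C'] [/= y'd CC'] s u x /andP[s0 sT] uM xs x0.
  rewrite leNgt; apply/negP => C'x; apply: nd; exists s, u, x; split => //.
  - by rewrite s0 (le_trans sT)// lerDl ltW.
  - by rewrite x0.
  - exact: lt_trans C'x.
move=> C [Cr CP]; exists (C + 1) => s u x sT uM xs xr.
by have /(_ (x 0) xr s u x) := CP (C + 1) (ltr_pwDr ltr01 (lexx C)); apply.
Qed.

(** The trajectories that explode from near [y] cross the sphere of radius
    [rho]; a cluster point of the crossings is again explosive, for the time
    left, and by [traj_backward] it can be reached exactly. *)
Lemma explosive_step (M rho th : R) (y : V) : explosive M y th -> `|y| < rho ->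
  exists y1 sg, [/\ `|y1| = rho, explosive M y1 (th - sg) &
    forall d, 0 < d -> exists s u x, [/\ 0 <= s, `|s - sg| < d,
      admissible 0 s M u, traj `[0, s] u x & `|x 0 - y| < d /\ x s = y1]].
Proof.
move=> ey yrho; have th0 := explosive_ge0 ey.
pose d0 := Num.min 1 (rho - `|y|).
have d00 : 0 < d0 by rewrite lt_min ltr01 subr_gt0.
pose dk (k : nat) := d0 / k.+1%:R.
have dk0 k : 0 < dk k by rewrite divr_gt0.
have dkd0 k : dk k <= d0 by rewrite ler_pdivrMr// ler_peMr ?ler1n// ltW.
pose Q k (z : R * R * (R -> U) * (R -> V)) :=
  let: (s, t, u, x) := z in
  [/\ 0 <= t <= s /\ s <= th + dk k, admissible 0 s M u, traj `[0, s] u x,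
    `|x 0 - y| < dk k /\ k%:R < `|x s| &
    `|x t| = rho /\ forall r, 0 <= r <= t -> `|x r| <= rho].
have exQ k : exists z, Q k z.
  have [s [u [x [/andP[s0 sd] uM xs xy Cx]]]] := ey (Num.max rho k%:R) (dk k) (dk0 k).
  move: Cx; rewrite gt_max => /andP[rx kx].
  have xc : {within `[0, s], continuous (fun t => `|x t|)}.
    by move=> t; apply: continuous_comp;
      [exact: (ode_solution_continuous xs)|exact: norm_continuous].
  have x0 : `|x 0| < rho.
    rewrite -(subrK y (x 0)); apply: le_lt_trans (ler_normD _ _) _.
    rewrite -ltrBrDr; apply: lt_le_trans xy _; apply: le_trans (dkd0 k) _.
    by rewrite /d0 ge_min lexx orbT.
  have [t /andP[t0 ts] [xt xle]] := first_hit s0 xc x0 (ltW rx).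
  by exists (s, t, u, x); split => //; split => //; rewrite t0.
have [z zQ] := choice exQ.
pose w k : V * R := let: (s, t, u, x) := z k in (x t, t).
have cK : compact ([set v : V | `|v| <= rho] `*` `[0, th + 1]%classic).
  by apply: compact_setX; [exact: compact_ball|exact: segment_compact].
have wK k : ([set v : V | `|v| <= rho] `*` `[0, th + 1]%classic) (w k).
  rewrite /w; have := zQ k; case: (z k) => [[[s t] u] x] [[/andP[t0 ts] sd] _ _ _ [xt _]].
  split; rewrite /= ?xt// in_itv/= t0/= (le_trans ts)// (le_trans sd)// lerD2l.
  by rewrite (le_trans (dkd0 k))// /d0 ge_min lexx.
have [[y1 sg] _ cl] := compact_cluster cK wK.
have clP (e : R) (k0 : nat) : 0 < e -> exists2 k, (k0 <= k)%N &
    `|(w k).1 - y1| < e /\ `|(w k).2 - sg| < e.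
  move=> e0; apply: (cl ([set v | `|v - y1| < e] `*` [set s | `|s - sg| < e])).
  exists ([set v | `|v - y1| < e], [set s | `|s - sg| < e]) => //=; split.
    by apply/nbhs_ballP; exists e => //= v; rewrite -ball_normE /= distrC.
  by apply/nbhs_ballP; exists e => //= s; rewrite -ball_normE /= distrC.
exists y1, sg; split.
- apply/eqP; rewrite -subr_eq0 -normr_le0; apply/ler_addgt0Pr => e e0.
  have [k _ [+ _]] := clP e 0%N e0; rewrite /w.
  have := zQ k; case: (z k) => [[[s t] u] x] [_ _ _ _ [xt _]] /= h.
  rewrite add0r -xt distrC; apply: le_trans (ltW h).
  exact: ler_dist_dist.
- move=> C d d_gt0; pose k0 := (Num.truncn (Num.max C (2 * d0 / d))).+1.
  have d2 : 0 < d / 2 by rewrite divr_gt0.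
  have [k k0k []] := clP (d / 2) k0 d2; rewrite /w.
  have kk : Num.max C (2 * d0 / d) < k%:R.
    by apply: lt_le_trans (truncnS_gt _) _; rewrite ler_nat.
  have dkd : dk k < d / 2.
    rewrite /dk ltr_pdivrMr// -ltr_pdivrMl// mulrC.
    have : 2 * d0 / d < k%:R by move: kk; rewrite gt_max => /andP[].
    rewrite -natr1; have -> : d0 / (d / 2) = 2 * d0 / d by field; rewrite gt_eqF.
    lra.
  have := zQ k; case: (z k) => [[[s t] u] x] [[/andP[t0 ts] sd] uM xs [_ kx] _] /= h1 h2.
  have st : s = (s - t) + t by rewrite subrK.
  exists (s - t), (fun r => u (r + t)), (fun r => x (r + t)); split.
  + by rewrite subr_ge0 ts/=; move: h2; rewrite ltr_norml => /andP[]; lra.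
  + apply: admissible_shift; rewrite add0r subrK.
    by apply: admissibleS uM.
  + apply: traj_shift; rewrite add0r subrK; apply: ode_solutionS xs => r /=.
    by rewrite !in_itv/= => /andP[h ->]; rewrite (le_trans t0).
  + by rewrite add0r; apply: lt_trans h1 _; lra.
  + by rewrite subrK; apply: lt_trans kx; move: kk; rewrite gt_max => /andP[].
- move=> d d_gt0; pose k0 := (Num.truncn (2 * d0 / d)).+1.
  have d2 : 0 < d / 2 by rewrite divr_gt0.
  have [eta eta0 etaP] := traj_backward rho M (th + 1) d2.
  have m0 : 0 < Num.min eta d by rewrite lt_min eta0.
  have [k k0k []] := clP _ k0 m0; rewrite /w.
  have dkd : dk k < d / 2.
    rewrite /dk ltr_pdivrMr// -ltr_pdivrMl// mulrC.
    have : 2 * d0 / d < k%:R.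
      by apply: lt_le_trans (truncnS_gt _) _; rewrite ler_nat.
    rewrite -natr1; have -> : d0 / (d / 2) = 2 * d0 / d by field; rewrite gt_eqF.
    lra.
  have := zQ k; case: (z k) => [[[s t] u] x] [[/andP[t0 ts] sd] uM xs [x0 _] [xt xr]] /=.
  rewrite !lt_min => /andP[h1 _] /andP[_ h2].
  have uMt : admissible 0 t M u by apply: admissibleS uM.
  have sT : s <= th + 1.
    by apply: le_trans sd _; rewrite lerD2l (le_trans (dkd0 k))// /d0 ge_min lexx.
  have [|||x' [x's x't x'0]] := etaP 0 t u x y1 t0 _ uMt _ xr.
  + by rewrite subr0 (le_trans ts).
  + apply: ode_solutionS xs => r /=.
    by rewrite !in_itv/= => /andP[-> h]; rewrite (le_trans h).
  + by rewrite distrC ltW.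
  exists t, u, x'; split => //; split => //.
  have -> : x' 0 - y = (x' 0 - x 0) + (x 0 - y) by rewrite addrA subrK.
  by apply: le_lt_trans (ler_normD _ _) _; lra.
Qed.

(** A stage of the construction of an exploding trajectory: initial state,
    control, final time, time left, and radius of the ball of initial states
    for which the control already produces a large trajectory. *)
Record stage := Stage { st_q : V ; st_u : R -> U ; st_t : R ; st_th : R ; st_e : R }.

(** The lower bound is required of all trajectories issued from the ball, so that
    it holds for the one issued from the limit of the centres. *)
Let stage_inv (M S : R) (N : nat) (p : stage) : Prop :=
  [/\ 0 <= st_t p, st_t p + st_th p < S, 0 < st_e p,
      admissible 0 (st_t p) M (st_u p) &
      (exists x, [/\ traj `[0, st_t p] (st_u p) x, x 0 = st_q p &
         explosive M (x (st_t p)) (st_th p)]) /\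
      forall x, traj `[0, st_t p] (st_u p) x -> `|x 0 - st_q p| <= st_e p ->
         N%:R <= `|x (st_t p)|].

Let stage_next (p p' : stage) : Prop :=
  [/\ st_t p <= st_t p', forall t, t < st_t p -> st_u p' t = st_u p t &
      `|st_q p' - st_q p| + st_e p' <= st_e p].

(** The excursion of [explosive_step] prolongs the control; the initial state is
    moved so that the trajectory meets the excursion exactly, and forward
    continuity provides the new ball around it. *)
Let stage_step (M S : R) (N : nat) (p : stage) : stage_inv M S N p ->
  exists p', stage_inv M S N.+1 p' /\ stage_next p p'.
Proof.
move: p => [q u t th e] [/= t0 tS e0 uM [[x [xs xq ex]] _]].
have [rho rho0 xr] := continuous_bounded (ode_solution_continuous xs).
have e20 : 0 < e / 2 by rewrite divr_gt0.
have [d1 d10 d1P] := traj_backward rho M t e20.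
pose d := Num.min d1 (S - (t + th)).
have d0 : 0 < d by rewrite lt_min d10 subr_gt0.
have xrho : `|x t| < `|x t| + N.+2%:R by rewrite ltrDl.
have [y1 [sg [y1E ey1 y1P]]] := explosive_step ex xrho.
have [s [v [y [s0 ssg vM ys [yx ysE]]]]] := y1P d d0.
have [||x' [x's x't x'0]] := d1P 0 t u x (y 0) t0 _ uM xs xr.
- by rewrite subr0.
- by apply: ltW; apply: lt_le_trans yx _; rewrite ge_min lexx.
have ts : t <= t + s by rewrite lerDl.
pose u' r := if r < t then u r else v (r - t).
pose z r := if r <= t then x' r else y (r - t).
have u'M : admissible 0 (t + s) M u'.
  apply: admissible_glue => //; apply: admissible_shift.
  by rewrite subrr addrAC subrr add0r.
have zs : traj `[0, t + s] u' z.
  apply: traj_glue => //; first by rewrite subrr.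
  apply: (traj_shift (c := - t)).
  by rewrite subrr addrAC subrr add0r.
have zE : z (t + s) = y1.
  rewrite /z; case: ifPn => [ts0|_]; last by rewrite addrAC subrr add0r.
  have s00 : s = 0 by apply/eqP; rewrite eq_le s0 andbT -(lerD2l t) addr0.
  by rewrite -ysE s00 addr0.
have z0 : z 0 = x' 0 by rewrite /z t0.
have ts0 : 0 <= t + s by rewrite addr_ge0.
have [e' e'0 e'P] := traj_forward_continuity ts0 u'M.2 zs ltr01.
exists (Stage (x' 0) u' (t + s) (th - sg) (Num.min e' (e / 2))); split.
- split => //=.
  + move: ssg; rewrite ltr_norml lt_min => /andP[_].
    by move=> /andP[]; lra.
  + by rewrite lt_min e'0.
  + split; first by exists z; split => //; rewrite zE.
    move=> w ws; rewrite le_min => /andP[we _].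
    have wy : `|w (t + s) - y1| <= 1 by rewrite -zE; apply: e'P => //; rewrite z0.
    have y1w : `|y1| <= `|w (t + s)| + `|w (t + s) - y1|.
      rewrite -{1}(subrK (w (t + s)) y1) addrC distrC.
      exact: ler_normD.
    have := le_trans y1w (lerD (lexx _) wy).
    by rewrite y1E -[N.+2%:R](natr1 N.+1); have := normr_ge0 (x t); lra.
- split => //=.
  + by move=> r rt; rewrite /u' rt.
  + rewrite -xq; have : Num.min e' (e / 2) <= e / 2 by rewrite ge_min lexx orbT.
    lra.
Qed.

(** Forward completeness, which bounds each trajectory separately, gives bounds
    uniform over states and controls. Otherwise controls steering a decreasing
    sequence of balls of initial states to larger and larger states can be
    concatenated; the trajectory issued from a common point of these balls
    contradicts forward completeness. *)
Lemma reachable_bounded0 (r M T : R) : exists C : R,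
  forall s u x, 0 <= s <= T -> admissible 0 s M u -> traj `[0, s] u x ->
    `|x 0| <= r -> `|x s| <= C.
Proof.
apply: contrapT => /explosive_exists[y ey].
have T0 := explosive_ge0 ey.
have T1 : T < T + 1 by rewrite ltrDl.
have M0 : 0 <= M.
  have [s [u [x [/andP[s0 _] [_ uM] _ _ _]]]] := ey 0 1 ltr01.
  by apply: le_trans (uM 0 _); rewrite ?lexx.
pose p0 := Stage y (fun=> 0) 0 T 1.
have inv0 : stage_inv M (T + 1) 0 p0.
  split => //=; first by rewrite add0r.
    split; first exact: lebesgue_measurable_fun_cst.
    by move=> t _; rewrite normr0.
  split; last by move=> x _ _; exact: normr_ge0.
  have adm0 : admissible 0 0 M (fun=> 0 : U).
    split; first exact: lebesgue_measurable_fun_cst.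
    by move=> t _; rewrite normr0.
  by have [x [xs x0]] := traj_exists y f_fc adm0; exists x; rewrite x0.
have [next nextP] := choice (fun Np : nat * stage =>
  match pselect (stage_inv M (T + 1) Np.1 Np.2) with
  | left h => let: ex_intro p' hp := stage_step h in
      ex_intro (fun p' => stage_inv M (T + 1) Np.1 Np.2 ->
        stage_inv M (T + 1) Np.1.+1 p' /\ stage_next Np.2 p') p' (fun=> hp)
  | right nh => ex_intro _ Np.2 (fun h => False_ind _ (nh h))
  end).
pose p := fix p N := if N is N'.+1 then next (N', p N') else p0.
have pinv N : stage_inv M (T + 1) N (p N).
  by elim: N => [//|N IH]; have [] := nextP (N, p N) IH.
have pnext N : stage_next (p N) (p N.+1) by have [] := nextP (N, p N) (pinv N).
have tmono N k : st_t (p N) <= st_t (p (N + k)%N).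
  elim: k => [|k IH]; first by rewrite addn0.
  by rewrite addnS; apply: le_trans IH _; have [] := pnext (N + k)%N.
have uE N k t : t < st_t (p N) -> st_u (p (N + k)%N) t = st_u (p N) t.
  move=> tN; elim: k => [|k <-]; first by rewrite addn0.
  rewrite addnS; have [_ -> //] := pnext (N + k)%N.
  exact: lt_le_trans (tmono N k).
have qE N k : `|st_q (p (N + k)%N) - st_q (p N)| + st_e (p (N + k)%N) <= st_e (p N).
  elim: k => [|k IH]; first by rewrite addn0 subrr normr0 add0r.
  apply: le_trans IH; rewrite addnS; have [_ _ h] := pnext (N + k)%N.
  rewrite -[X in `|X| + _](subrKA (st_q (p (N + k)%N))).
  by have := ler_normD (st_q (p (N + k).+1) - st_q (p (N + k)%N))
    (st_q (p (N + k)%N) - st_q (p N)); lra.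
have egt0 N : 0 < st_e (p N) by have [] := pinv N.
have tge0 N : 0 <= st_t (p N) by have [] := pinv N.
have tT N : st_t (p N) <= T + 1.
  have [_ h _ _ [[x [_ _ ex]] _]] := pinv N; have := explosive_ge0 ex; lra.
(* The balls of initial states decrease, so their centres cluster in all of them. *)
have [q qP] : exists q : V, forall N, `|q - st_q (p N)| <= st_e (p N).
  have [|q _ cl] := @compact_cluster _ _ (fun N => st_q (p N)) (@compact_ball R n (`|y| + 1)).
    move=> N /=; have := qE 0%N N; rewrite add0n /= => h.
    have := ler_normD (st_q (p N) - y) y; rewrite subrK; have := ltW (egt0 N); lra.
  exists q => N; apply/ler_addgt0Pr => e e0.
  have [|k Nk /= qk] := cl [set v | `|v - q| < e] _ N.
    by apply/nbhs_ballP; exists e => //= v; rewrite -ball_normE /= distrC.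
  have := qE N (k - N)%N; rewrite subnKC// => h.
  rewrite -[X in `|X| <= _](subrKA (st_q (p k))).
  apply: le_trans (ler_normD _ _) _; rewrite addrC lerD//; last by rewrite distrC ltW.
  by apply: le_trans h; rewrite lerDl ltW.
(* Concatenation of the controls, extended by 0 past their final times. *)
pose reached t N := t < st_t (p N).
pose u t := if pselect (exists N, reached t N) is left h
  then st_u (p (projT1 (cid h))) t else 0.
have uP N t : t < st_t (p N) -> u t = st_u (p N) t.
  move=> tN; rewrite /u; case: pselect => [h|]; last by case; exists N.
  case: cid => k /= tk; have [kN|/ltnW Nk] := leqP k N.
    by rewrite -(subnKC kN) uE.
  by rewrite -(subnKC Nk) uE.
have uadm : Linfty_loc `[0, +oo[ u.
  split; last first.
    move=> a b ab; apply/bounded_onP; exists M => t /ab; rewrite /= in_itv/= andbT => t0.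
    rewrite /u; case: pselect => [h|_]; last by rewrite normr0.
    case: cid => k /= tk; have [_ _ _ [_ uM] _] := pinv k.
    by apply: uM; rewrite t0 ltW.
  pose E : set R := \bigcup_N `[0, st_t (p N)[%classic.
  have mE : measurable (E : set (@lebesgueTypeR R)).
    by apply: bigcupT_measurable => N; exact: lebesgue_measurable_itv.
  have mE' : measurable ((`[0, +oo[%classic `\` E) : set (@lebesgueTypeR R)).
    by apply: measurableD => //; exact: lebesgue_measurable_itv.
  have -> : `[0, +oo[%classic = E `|` (`[0, +oo[%classic `\` E) :> set R.
    apply/seteqP; split => t.
      by move=> t0; have [Et|nEt] := pselect (E t); [left|right].
    by move=> [[N _ /=]|[]//]; rewrite !in_itv/= andbT => /andP[].
  apply: lebesgue_measurable_funU mE mE' _ _.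
    move=> j; apply/measurable_fun_bigcup; first by move=> N; exact: lebesgue_measurable_itv.
    move=> N; have [_ _ _ [mu_ _] _] := pinv N.
    have : lebesgue_measurable_fun `[0, st_t (p N)[ u.
      apply: (@eq_lebesgue_measurable_fun _ _ _ (st_u (p N))).
        by move=> t /=; rewrite in_itv/= => /andP[_ /uP].
      apply: lebesgue_measurable_funS (lebesgue_measurable_itv _) _ mu_.
      by move=> t /=; rewrite !in_itv/= => /andP[-> /ltW].
    exact.
  apply: (@eq_lebesgue_measurable_fun _ _ _ (fun=> 0)).
    move=> t [+ nE]; rewrite /= in_itv/= andbT => t0.
    rewrite /u; case: pselect => // -[N tN]; exfalso; apply: nE.
    by exists N => //=; rewrite in_itv/= t0.
  exact: lebesgue_measurable_fun_cst.
have [x [xs xq]] := traj_exists_infty q f_fc uadm.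
have xs' b : traj `[0, b] u x.
  by apply: ode_solutionS xs => t /=; rewrite !in_itv/= andbT => /andP[].
have [C C0 CP] := continuous_bounded (ode_solution_continuous (xs' (T + 1))).
pose N := (Num.truncn C).+1.
have [_ _ _ _ [_ big]] := pinv N.
have : N%:R <= `|x (st_t (p N))|.
  apply: big; last by rewrite xq qP.
  apply: eq_ode_rhs (negligible1 (st_t (p N))) _ (xs' _) => t /=.
  rewrite in_itv/= => /andP[_]; rewrite le_eqVlt => /orP[/eqP //|tN _].
  by rewrite (uP N).
have := CP (st_t (p N)); rewrite tge0 tT => /(_ isT).
by have := truncnS_gt C; rewrite -/N; lra.
Qed.

(** The system being autonomous, trajectories can be shifted to start at time 0. *)
Lemma reachable_bounded (r M T : R) : exists C : R,
  forall a b u x, a <= b -> b - a <= T -> admissible a b M u -> traj `[a, b] u x ->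
    `|x a| <= r -> `|x b| <= C.
Proof.
have [C CP] := reachable_bounded0 r M T; exists C => a b u x ab baT uM xs xr.
have baK : b - a + a = b by rewrite subrK.
have := CP (b - a) (fun t => u (t + a)) (fun t => x (t + a)).
rewrite add0r baK; apply => //; first by rewrite subr_ge0 ab.
- by apply: admissible_shift; rewrite add0r baK.
- by apply: traj_shift; rewrite add0r baK.
Qed.

End reachability.

(** * Comparison functions *)

Section comparison_tools.
Context {R : realType}.

Lemma within_continuous_comp (V W Z : normedModType R) (A : set V) (B : set W)
    (h : V -> W) (k : W -> Z) : (forall x, A x -> B (h x)) ->
  {within A, continuous h} -> {within B, continuous k} ->
  {within A, continuous (k \o h)}.
Proof.
move=> AB /within_continuousP hc /within_continuousP kc; apply/within_continuousP.
move=> x Ax e e0; have [d d0 dP] := kc _ (AB x Ax) e e0.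
have [d' d'0 d'P] := hc x Ax d d0; exists d' => // y Ay yx /=.
by apply: dP; [exact: AB|exact: d'P].
Qed.

Lemma within_continuousD (T : topologicalType) (W : normedModType R) (A : set T)
    (h k : T -> W) : {within A, continuous h} -> {within A, continuous k} ->
  {within A, continuous (fun x => h x + k x)}.
Proof.
move=> /subspace_continuousP hc /subspace_continuousP kc.
by apply/subspace_continuousP => x Ax; apply: cvgD; [exact: hc|exact: kc].
Qed.

Lemma within_continuousM (T : topologicalType) (A : set T) (h k : T -> R) :
  {within A, continuous h} -> {within A, continuous k} ->
  {within A, continuous (fun x => h x * k x)}.
Proof.
move=> /subspace_continuousP hc /subspace_continuousP kc.
by apply/subspace_continuousP => x Ax; apply: cvgM; [exact: hc|exact: kc].
Qed.

Lemma class_K_ge0 (g : R -> R) : class_K g -> forall s, 0 <= s -> 0 <= g s.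
Proof.
move=> [g0 _ gm] s; rewrite le_eqVlt => /orP[/eqP<-|s0]; first by rewrite g0.
by rewrite -g0 ltW// gm// in_itv/= ?lexx// ltW.
Qed.

Lemma class_K_le (g : R -> R) : class_K g -> forall s t, 0 <= s -> s <= t -> g s <= g t.
Proof.
move=> [_ _ gm] s t s0; rewrite le_eqVlt => /orP[/eqP<-//|st].
by rewrite ltW// gm// in_itv/= andbT// (le_trans s0)// ltW.
Qed.

Let Kitv : (forall s : R, (0 <= s) = (s \in `[0, +oo[)).
Proof. by move=> s; rewrite in_itv/= andbT. Qed.

Lemma class_K_id : class_K (@id R).
Proof.
split; [by []| |by move=> s t _ _].
by apply: continuous_subspaceT => x; exact: cvg_id.
Qed.

Lemma class_K_comp (g h : R -> R) : class_K g -> class_K h -> class_K (g \o h).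
Proof.
move=> gK hK; have [g0 gc gm] := gK; have [h0 hc hm] := hK; split => /=.
- by rewrite h0.
- apply: within_continuous_comp hc gc => x /=.
  by rewrite -!Kitv; exact: class_K_ge0.
- move=> s t s0 t0 st; apply: gm; rewrite -?Kitv ?class_K_ge0// ?Kitv//.
  exact: hm.
Qed.

Lemma class_KD (g h : R -> R) : class_K g -> class_K h ->
  class_K (fun s => g s + h s).
Proof.
move=> [g0 gc gm] [h0 hc hm]; split.
- by rewrite g0 h0 addr0.
- exact: within_continuousD.
- by move=> s t s0 t0 st; rewrite ltrD// ?gm ?hm.
Qed.

Lemma class_K_scale (c : R) (g : R -> R) : 0 < c -> class_K g ->
  class_K (fun s => c * g s).
Proof.
move=> c0 [g0 gc gm]; split.
- by rewrite g0 mulr0.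
- apply: (@within_continuous_comp _ _ _ _ setT g (fun y => c * y)) => //.
  by apply: continuous_subspaceT => y; apply: cvgM; [exact: cvg_cst|exact: cvg_id].
- by move=> s t s0 t0 st; rewrite ltr_pM2l// gm.
Qed.

(** The monotone function [b] may jump. It is regularized into the supremum [c] of
    the translates of a Lipschitz bump weighted by the values of [b], which stays
    above [b]; a factor [s] then forces the value 0 at the origin. *)
Lemma class_K_majorant (b : R -> R) (C d : R) : 0 <= C -> 0 < d ->
  (forall s, 0 <= s -> 0 <= b s) ->
  (forall s t, 0 <= s -> s <= t -> b s <= b t) ->
  (forall s, 0 <= s -> s <= d -> b s <= C * s) ->
  exists2 K, class_K K & forall s, 0 <= s -> b s <= K s.
Proof.
move=> C0 d0 b0 bm bC.
pose bump (z : R) := Num.max 0 (Num.min 1 z).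
have bump01 z : 0 <= bump z <= 1.
  by rewrite /bump le_max lexx ge_max ler01 ge_min lexx.
have bumpL z z' : bump z <= bump z' + `|z - z'|.
  rewrite /bump; have := normr_ge0 (z - z'); have := ler_norm (z - z').
  by rewrite /Num.max /Num.min; do ![case: ifPn]; rewrite -?leNgt; lra.
pose A s := [set b y * bump (1 + s - y) | y in [set y | 0 <= y]].
have Ab s v : 0 <= s -> A s v -> v <= b (s + 1).
  move=> s0 [y /= y0 <-]; have [ys|sy] := leP y (s + 1).
    apply: le_trans (bm _ _ y0 ys); rewrite ler_piMr ?b0//.
    by have /andP[] := bump01 (1 + s - y).
  have -> : bump (1 + s - y) = 0.
    by rewrite /bump /Num.max /Num.min; do ![case: ifPn]; rewrite -?leNgt; lra.
  by rewrite mulr0 b0// addr_ge0.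
have A0 s : A s !=set0 by exists (b 0 * bump (1 + s - 0)); exists 0 => //=.
have hA s : 0 <= s -> has_sup (A s).
  by move=> s0; split => //; exists (b (s + 1)) => v; exact: Ab.
pose c s := sup (A s).
have cge s y : 0 <= s -> 0 <= y -> b y * bump (1 + s - y) <= c s.
  by move=> s0 y0; apply: sup_upper_bound; [exact: hA|exists y].
have cb s : 0 <= s -> b s <= c s.
  move=> s0; have := cge s s s0 s0; rewrite addrK.
  by rewrite /bump minxx max_r ?ler01// mulr1.
have c0 s : 0 <= s -> 0 <= c s by move=> s0; apply: le_trans (cb s s0); exact: b0.
have cm s t : 0 <= s -> s <= t -> c s <= c t.
  move=> s0 st; apply: ge_sup => // v [y /= y0 <-].
  apply: le_trans (cge t y (le_trans s0 st) y0).
  rewrite ler_wpM2l ?b0// /bump.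
  by rewrite /Num.max /Num.min; do ![case: ifPn]; rewrite -?leNgt; lra.
have cL a s t : 0 <= s -> s <= a -> 0 <= t -> t <= a ->
    c s <= c t + b (a + 1) * `|s - t|.
  move=> s0 sa t0 ta; apply: ge_sup => // v [y /= y0 <-].
  have [ys|sy] := leP y (a + 1); last first.
    have -> : bump (1 + s - y) = 0.
      by rewrite /bump /Num.max /Num.min; do ![case: ifPn]; rewrite -?leNgt; lra.
    by rewrite mulr0 addr_ge0 ?c0// mulr_ge0// b0; lra.
  apply: (@le_trans _ _ (b y * (bump (1 + t - y) + `|s - t|))).
    rewrite ler_wpM2l ?b0//; apply: le_trans (bumpL _ (1 + t - y)) _.
    by rewrite lerD2l (_ : 1 + s - y - _ = s - t)//; lra.
  by rewrite mulrDr lerD ?cge// ler_wpM2r// bm.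
have cc : {within `[0, +oo[, continuous c}.
  apply/within_continuousP => s; rewrite /= in_itv/= andbT => s0 e e0.
  pose B := b (s + 1 + 1) + 1.
  have B0 : 0 < B by rewrite /B ltr_wpDl// b0; lra.
  exists (Num.min 1 (e / B)) => [|t]; first by rewrite lt_min ltr01 divr_gt0.
  rewrite /= in_itv/= andbT lt_min => t0 /andP[ts1 tse].
  have ts : t <= s + 1 by have := ler_norm (t - s); lra.
  have s1 : s <= s + 1 by lra.
  have H1 := cL (s + 1) t s t0 ts s0 s1.
  have H2 := cL (s + 1) s t s0 s1 t0 ts; rewrite (distrC s) in H2.
  have H3 : B * `|t - s| < e by rewrite mulrC -ltr_pdivlMr.
  have H4 : b (s + 1 + 1) * `|t - s| <= B * `|t - s| by rewrite ler_wpM2r// lerDl.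
  by rewrite ltr_norml; apply/andP; split; lra.
(* Above [d] the factor [s / d] is at least 1 and [c s] is above [b s]; below [d]
   the linear bound applies, and the summand 1 makes the product increase
   strictly even where [c] vanishes. *)
exists (fun s => s * (C + 1 + c s / d)).
  split.
  - by rewrite mul0r.
  - apply: within_continuousM; first by apply: continuous_subspaceT => x; exact: cvg_id.
    apply: within_continuousD; first exact/continuous_subspaceT/cst_continuous.
    by apply: within_continuousM cc _; exact/continuous_subspaceT/cst_continuous.
  - move=> s t; rewrite -!Kitv => s0 t0 st.
    have cst := cm s t s0 (ltW st).
    have cd : c s / d <= c t / d by rewrite ler_pM2r ?invr_gt0.
    have cs0 : 0 <= c s / d by rewrite divr_ge0 ?c0// ltW.
    apply: (@le_lt_trans _ _ (s * (C + 1 + c t / d))).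
      by rewrite ler_wpM2l// lerD2l.
    by rewrite ltr_pM2r//; lra.
move=> s s0; have cs0 : 0 <= c s / d by rewrite divr_ge0 ?c0// ltW.
have [sd|ds] := leP s d.
  apply: le_trans (bC s s0 sd) _; rewrite mulrC ler_wpM2l//; lra.
apply: (@le_trans _ _ (s * (c s / d))); last by rewrite ler_wpM2l//; lra.
apply: le_trans (cb s s0) _; rewrite mulrCA ler_peMr ?c0//.
by rewrite ler_pdivlMr// mul1r ltW.
Qed.

End comparison_tools.

(** * Gain of a forward complete system *)

Section reach_gain.
Context {R : realType} {n m : nat} (f : 'rV[R]_n -> 'rV[R]_m -> 'rV[R]_n).
Local Notation V := 'rV[R]_n.
Local Notation U := 'rV[R]_m.
Local Notation traj I u := (ode_solution I (fun t y => f y (u t))).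
Hypotheses (f_lip : locally_lipschitz f) (f_fc : forward_complete f).
Hypothesis f00 : f 0 0 = 0.

(** Near the equilibrium the trajectory grows at most linearly with the data,
    by comparison with the zero solution. *)
Let small_data (T : R) : exists2 N : nat, True & forall a b s (u : R -> U) x,
  a <= b -> b - a <= T -> admissible a b s u -> traj `[a, b] u x -> `|x a| <= s ->
  4 ^+ N * (2 * s) <= 4^-1 -> `|x b| <= 4 ^+ N * (2 * s).
Proof.
have [L L0 LP] := lipschitz_on_ball f_lip 1.
pose N := (Num.truncn (4 * L * T)).+1.
exists N => // a b s u x ab baT [mu_ us] xs xa sN.
have s0 : 0 <= s by apply: le_trans xa.
have N1 : 1 <= 4 ^+ N :> R by rewrite exprn_ege1//; lra.
have s1 : s <= 1.
  have : 1 * (2 * s) <= 4 ^+ N * (2 * s) by rewrite ler_wpM2r// mulr_ge0.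
  by lra.
have ys : ode_solution `[a, b] (fun _ _ => 0) (fun=> 0 : V).
  split; last by apply/aeW => t _; exact: is_derive_cst.
  move=> a' b' _ e e0; exists 1 => // k l r _ _ _.
  by rewrite big1// => i _; rewrite subrr enorm0.
have xaE : `|x a - 0| + s <= 2 * s by rewrite subr0; lra.
have N0 : 0 < 4 ^+ N :> R by rewrite exprn_gt0.
have := @growth _ _ _ _ x (fun=> 0) L s L0 s0 N a b ab xs ys.
move=> /(_ _ _ _ b); rewrite ab lexx => H.
rewrite -[x b]subr0; apply: le_trans (H _ _ _ isT) _.
- move=> t tab; rewrite !subr0 => xt1.
  have := LP (x t) 0 (u t) 0; rewrite f00 !subr0 !normr0 => H'.
  apply: le_trans (H' xt1 ler01 _ ler01) _; first exact: le_trans (us t tab) s1.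
  by rewrite ler_wpM2l ?lerD2l ?us// ltW.
- have : L * (b - a) <= L * T by rewrite ler_pM2l.
  by have := truncnS_gt (4 * L * T); rewrite -/N; lra.
- by apply: le_trans sN; rewrite ler_pM2l.
- by rewrite ler_pM2l.
Qed.

(** Bounded reachability makes the supremum of the states reached from data of
    size [s] finite, and [small_data] makes it linear near 0, hence dominated by
    a class K function. *)
Lemma reachable_class_K (T : R) : 0 <= T -> exists2 beta : R -> R, class_K beta &
  forall a b s (u : R -> U) x, a <= b -> b - a <= T -> admissible a b s u ->
    traj `[a, b] u x -> `|x a| <= s -> `|x b| <= beta s.
Proof.
move=> T0.
pose A s : set R := [set c | exists a b u x, [/\ a <= b /\ b - a <= T,
  admissible a b s u, traj `[a, b] u x, `|x a| <= s & c = `|x b|]].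
have A0 s : 0 <= s -> A s 0.
  move=> s0; have adm : admissible 0 0 s (fun=> 0 : U).
    by split; [exact: lebesgue_measurable_fun_cst|move=> t _; rewrite normr0].
  have [x [xs x0]] := traj_exists (0 : V) f_fc adm.
  by exists 0, 0, (fun=> 0), x; rewrite x0 subrr normr0.
have hA s : 0 <= s -> has_sup (A s).
  move=> s0; split; first by exists 0; exact: A0.
  have [C CP] := reachable_bounded f_lip f_fc s s T.
  by exists C => _ [a [b [u [x [[ab baT] us xs xa ->]]]]]; exact: CP us xs xa.
pose beta s := sup (A s).
have ub s : 0 <= s -> ubound (A s) (beta s) by move=> s0; apply: sup_upper_bound; exact: hA.
have [N _ NP] := small_data T.
have N0 : 0 < 4 ^+ N :> R by rewrite exprn_gt0.
have [||||| K KK bK] := @class_K_majorant R beta (4 ^+ N * 2) (4^-1 / (4 ^+ N * 2)).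
- by rewrite mulr_ge0// ltW.
- by rewrite divr_gt0// mulr_gt0.
- by move=> s s0; apply: ub => //; exact: A0.
- move=> s t s0 st; apply: ge_sup; first by exists 0; exact: A0.
  move=> _ [a [b [u [x [abT [mu_ us] xs xa ->]]]]].
  apply: ub; first exact: le_trans st.
  exists a, b, u, x; split => //; last exact: le_trans st.
  by split => // r rab; apply: le_trans (us r rab) st.
- move=> s s0 sd; apply: ge_sup; first by exists 0; exact: A0.
  move=> _ [a [b [u [x [[ab baT] us xs xa ->]]]]]; rewrite -mulrA.
  apply: NP us xs xa _ => //; rewrite mulrA mulrC -ler_pdivlMr// mulr_gt0.
exists K => // a b s u x ab baT us xs xa.
have s0 : 0 <= s by apply: le_trans xa.
by apply: le_trans (bK s s0); apply: ub => //; exists a, b, u, x.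
Qed.

End reach_gain.

(** * A KL bound that sets in after a delay *)

Section delayed_KL.
Context {R : realType}.

(** The factor [(S + 1) / (t + 1)] is at least 1 up to time [S] and tends to 0;
    the second term takes over from time [S] on. *)
Lemma class_KL_delay (G h : R -> R) (sigma : R -> R -> R) (S : R) :
  class_K G -> class_K h -> class_KL sigma -> 0 <= S ->
  exists2 sigma', class_KL sigma' &
    (forall s t, 0 <= s -> 0 <= t -> t <= S -> G s <= sigma' s t) /\
    (forall s t, 0 <= s -> S <= t -> h (sigma (G s) (t - S)) <= sigma' s t).
Proof.
move=> GK hK [sc sK sL] S0.
pose late t : R := Num.max (t - S) 0.
have late0 t : 0 <= late t by rewrite /late le_max lexx orbT.
have late_lip a b : `|late a - late b| <= `|a - b|.
  rewrite ler_norml; have := ler_norm (a - b); have := ler_norm (b - a).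
  by rewrite distrC /late /Num.max; do ![case: ifPn]; rewrite -?leNgt; lra.
have G0 := class_K_ge0 GK; have h0 := class_K_ge0 hK.
have s0 s t : 0 <= s -> 0 <= t -> 0 <= sigma s t by move=> s0 t0; exact: (class_K_ge0 (sK t t0)).
have frac0 t : 0 <= t -> 0 < (S + 1) / (t + 1) by move=> t0; rewrite divr_gt0//; lra.
have sdec s t t' : 0 <= s -> 0 <= t -> t <= t' -> sigma s t' <= sigma s t.
  move=> s_ t0 tt'; have [sm _] := sL s s_.
  by apply: sm => //; rewrite in_itv/= andbT// (le_trans t0).
exists (fun s t => G s * ((S + 1) / (t + 1)) + h (sigma (G s) (late t))); last first.
  split=> s t s_.
    move=> t0 tS; apply: (@le_trans _ _ (G s * ((S + 1) / (t + 1)))).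
      rewrite ler_peMr ?G0// ler_pdivlMr ?mul1r; lra.
    by rewrite lerDl h0// s0// G0.
  move=> St; rewrite /late max_l ?subr_ge0// lerDr mulr_ge0 ?G0//.
  by apply/ltW/frac0/le_trans/St.
split.
- have Qc (k : R -> R) : {within `[0, +oo[, continuous k} ->
      {within [set p : R * R | 0 <= p.1 /\ 0 <= p.2], continuous (fun p => k p.1)}.
    apply: within_continuous_comp => [p [p1 _]|]; first by rewrite /= in_itv/= andbT.
    by apply: continuous_subspaceT => p; exact: cvg_fst.
  have GKc : {within `[0, +oo[, continuous G} by case: GK.
  apply: within_continuousD; first apply: within_continuousM.
  + exact: Qc.
  + apply: within_continuousM; first exact/continuous_subspaceT/cst_continuous.
    apply/within_continuousP => p Hp.
    apply: (within_continuousP _ _).1 Hp; apply/subspace_continuousP => q [q1 q2] /=.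
    apply: cvgV; first by rewrite gt_eqF//; lra.
    apply: cvgD; last exact: cvg_cst.
    by apply: cvg_within_filter; exact: cvg_snd.
  + have : {within [set p : R * R | 0 <= p.1 /\ 0 <= p.2],
        continuous (fun p : R * R => (G p.1, late p.2))}.
      apply/within_continuousP => p Hp e e0.
      have [d d0 dP] := (within_continuousP _ _).1 (Qc G GKc) p Hp e e0.
      exists (Num.min d e) => [|q Hq]; rewrite lt_min ?d0// => /andP[qd qe].
      rewrite prod_normE /= gt_max dP//=; apply: le_lt_trans (late_lip _ _) _.
      by apply: le_lt_trans qe; rewrite [leRHS]prod_normE le_max lexx orbT.
    move=> Gl.
    have hc : {within `[0, +oo[, continuous h} by case: hK.
    have sGc : {within [set p : R * R | 0 <= p.1 /\ 0 <= p.2],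
        continuous ((fun p => sigma p.1 p.2) \o (fun p => (G p.1, late p.2)))}.
      apply: (within_continuous_comp _ Gl sc) => p [p1 p2] /=.
      by split; [exact: G0|].
    have /= := within_continuous_comp _ sGc hc; apply => p [p1 p2].
    by rewrite /= in_itv/= andbT s0// G0.
- move=> t t0; apply: class_KD.
  + have := class_K_scale (frac0 t t0) GK; congr class_K; apply/funext => s.
    by rewrite mulrC.
  + exact: (class_K_comp hK (class_K_comp (sK _ (late0 t)) GK)).
- move=> s s_; split.
    move=> t1 t2; rewrite !in_itv/= !andbT => t10 t20 t12.
    apply: lerD.
      rewrite ler_wpM2l ?G0// ler_wpM2l//; first lra.
      by rewrite lef_pV2 ?posrE; lra.
    apply: (class_K_le hK); first by rewrite s0// G0.
    apply: sdec; rewrite ?G0// /late ge_max !le_max lexx !orbT andbT.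
    by rewrite lerD2r t12.
  apply/cvgrPdist_lt => e e0; have e20 : 0 < e / 2 by rewrite divr_gt0.
  have [h00 hc _] := hK.
  have /within_continuousP/(_ 0) := hc; rewrite /= in_itv/= lexx => /(_ isT _ e20)[d d0 dP].
  have [_ /cvgrPdist_lt/(_ d d0)] := sL (G s) (G0 s s_).
  move=> [T [Tr TP]].
  exists (Num.max (Num.max T 0 + S) (G s * (S + 1) / (e / 2))); split; first exact: num_real.
  move=> t; rewrite gt_max => /andP[Tt Gt].
  have T0 : 0 <= Num.max T 0 by rewrite le_max lexx orbT.
  have TT : T <= Num.max T 0 by rewrite le_max lexx.
  have t0 : 0 < t by lra.
  have tS : 0 <= t - S by lra.
  have := TP (t - S); rewrite sub0r normrN => /(_ (le_lt_trans TT _)).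
  have -> : late t = t - S by rewrite /late max_l.
  rewrite ltrBrDr => /(_ Tt) sd.
  have sg0 : 0 <= sigma (G s) (t - S) by rewrite s0// G0.
  have := dP (sigma (G s) (t - S)); rewrite in_itv/= andbT sg0 subr0 h00 subr0.
  move=> /(_ isT sd); rewrite ger0_norm ?h0// => hlt.
  rewrite sub0r normrN ger0_norm; last first.
    by rewrite addr_ge0 ?h0// mulr_ge0 ?G0// ltW// frac0// ltW.
  have : G s * ((S + 1) / (t + 1)) < e / 2.
    rewrite mulrA ltr_pdivrMr; last lra.
    move: Gt; rewrite ltr_pdivrMr// => Gt; apply: lt_trans Gt _.
    by rewrite mulrC ltr_pM2l//; lra.
  by lra.
Qed.

End delayed_KL.

(** * Feedback and history norms *)

Section feedback.
Context {R : realType} {n m : nat} (k : R -> 'rV[R]_n -> 'rV[R]_m).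
Hypothesis k_C1 : C1_halfspace k.

Lemma norm_mulmx (v : 'rV[R]_n) (A : 'M[R]_(n, m)) :
  `|v *m A| <= n%:R * (`|v| * `|A|).
Proof.
apply: norm_le_entries => [|j]; first by rewrite !mulr_ge0.
rewrite mxE; apply: le_trans (ler_norm_sum _ _ _) _.
apply: (@le_trans _ _ (\sum_(i < n) `|v| * `|A|)).
  by apply: ler_sum => i _; rewrite normrM ler_pM// entry_le_norm.
by rewrite sumr_const card_ord mulr_natl.
Qed.

Lemma feedback_continuous (t : R) (x : 'rV[R]_n) : 0 <= t -> forall e : R, 0 < e ->
  exists2 d : R, 0 < d & forall s y, 0 <= s -> `|s - t| < d -> `|y - x| < d ->
    `|k s y - k t x| < e.
Proof.
move=> t0 e e0; have [Dt [Dx [_ _ /(_ (t, x) t0 1 ltr01)]]] := k_C1.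
move=> /nbhs_ballP[d /= d0 dP].
(* [B] collects the two partial derivatives at the point, and the error of the
   linear approximation at accuracy 1. *)
pose B := `|Dt (t, x)| + n%:R * `|Dx (t, x)| + 1 + n%:R + 1.
have B0 : 0 < B by rewrite /B ltr_wpDl// addr_ge0// addr_ge0// addr_ge0// mulr_ge0.
exists (Num.min d (e / B)) => [|s y s0]; first by rewrite lt_min d0 divr_gt0.
rewrite !lt_min => /andP[sd se] /andP[yd ye].
have /(_ _ s0)/= := dP (s, y).
rewrite -ball_normE /= => /(_ _)H.
have {}H : enorm (k s y - k t x - ((s - t) *: Dt (t, x) + (y - x) *m Dx (t, x)))
    <= 1 * (`|s - t| + enorm (y - x)).
  by apply: H; rewrite prod_normE /= gt_max distrC sd distrC yd.
pose q := Num.max `|s - t| `|y - x|.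
have q1 : `|s - t| <= q by rewrite le_max lexx.
have q2 : `|y - x| <= q by rewrite le_max lexx orbT.
have q0 : 0 <= q by apply: le_trans q1.
have qe : B * q < e by rewrite mulrC -ltr_pdivlMr// gt_max se.
apply: le_lt_trans qe.
rewrite -[X in `|X| <= _](subrK ((s - t) *: Dt (t, x) + (y - x) *m Dx (t, x))).
apply: le_trans (ler_normD _ _) _.
have H1 : `|k s y - k t x - ((s - t) *: Dt (t, x) + (y - x) *m Dx (t, x))| <= q + n%:R * q.
  apply: le_trans (norm_le_enorm _) _; apply: le_trans H _; rewrite mul1r lerD//.
  by apply: le_trans (enorm_le_norm _) _; rewrite ler_wpM2l.
have H2 : `|(s - t) *: Dt (t, x) + (y - x) *m Dx (t, x)| <=
    q * `|Dt (t, x)| + n%:R * (q * `|Dx (t, x)|).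
  apply: le_trans (ler_normD _ _) _; rewrite lerD//.
    by rewrite normrZ ler_wpM2r.
  apply: le_trans (norm_mulmx _ _) _.
  by rewrite ler_wpM2l// ler_wpM2r.
apply: le_trans (lerD H1 H2) _; rewrite /B.
by move: q0; move: (q) (`|Dt (t, x)|) (`|Dx (t, x)|) => p u v; lra.
Qed.

Variables (tau : R) (tau_ge0 : 0 <= tau).

Lemma feedback_measurable (a b : R) (z : R -> 'rV[R]_n) : 0 <= a ->
  (forall t, a < t < b -> {for t, continuous z}) ->
  lebesgue_measurable_fun `]a, b[ (fun t => k (t + tau) (z t)).
Proof.
move=> a0 zc; apply: lebesgue_measurable_fun_continuous; first exact: interval_open.
move=> t /=; rewrite in_itv/= => tab; apply/cvgrPdist_lt => e e0.
have t0 : 0 < t by case/andP: tab => at_ _; exact: le_lt_trans at_.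
have tt0 : 0 <= t + tau by rewrite addr_ge0// ltW.
have [d d0 dP] := feedback_continuous (z t) tt0 e0.
have /cvgrPdist_lt/(_ d d0) zt := zc t tab.
near=> s; rewrite distrC; apply: dP.
- by rewrite addr_ge0// ltW//; near: s; exact: lt_nbhsr.
- rewrite opprD addrACA subrr addr0; near: s.
  by apply/nbhs_ballP; exists d => //= s; rewrite /ball/= distrC.
- by rewrite distrC; near: s; exact: zt.
Unshelve. all: by end_near. Qed.

End feedback.

Section sup_norm.
Context {R : realType} {n : nat}.
Implicit Types (x : R -> 'rV[R]_n).

Lemma sup_norm_le (s : R) x (c : R) :
  (forall th, - s <= th <= 0 -> enorm (x th) <= c) -> (sup_norm s x <= c%:E)%E.
Proof.
move=> xc; apply: ge_ereal_sup => _ [th /= + <-]; rewrite in_itv/= => ths.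
by rewrite lee_fin xc.
Qed.

(** The bound [c] guarantees that the supremum is finite: [fine] would send an
    infinite one to 0. *)
Lemma le_sup_norm (s : R) x (c : R) : 0 <= s ->
  (forall th, - s <= th <= 0 -> enorm (x th) <= c) ->
  forall th, - s <= th <= 0 -> enorm (x th) <= fine (sup_norm s x).
Proof.
move=> s0 xc.
have up : (sup_norm s x <= c%:E)%E by exact: sup_norm_le.
have low th : - s <= th <= 0 -> ((enorm (x th))%:E <= sup_norm s x)%E.
  by move=> ths; apply: ereal_sup_ubound; exists th => //=; rewrite in_itv.
have fin : sup_norm s x \is a fin_num.
  rewrite ge0_fin_numE; first exact: le_lt_trans up (ltry _).
  apply: le_trans (low 0 _); first by rewrite lee_fin enorm_ge0.
  by rewrite oppr_le0 s0 lexx.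
by move=> th /low; rewrite -lee_fin fineK.
Qed.

End sup_norm.

(** * The closed loop between two sampling times *)

Section sampling.
Context {R : realType} (T t0 : R).
Hypothesis T_gt0 : 0 < T.
Local Notation ti := (sampling_time T t0).

Lemma sampling_time0 : ti 0 = t0.
Proof. by rewrite /sampling_time mul0r addr0. Qed.

Lemma sampling_timeS i : ti i.+1 = ti i + T.
Proof. by rewrite /sampling_time -natr1 mulrDl mul1r addrA. Qed.

Lemma sampling_time_le i j : (i <= j)%N -> ti i <= ti j.
Proof. by move=> ij; rewrite lerD2l ler_wpM2r ?ler_nat// ltW. Qed.

Lemma sampling_index t : t0 <= t -> exists i, ti i <= t < ti i.+1.
Proof.
move=> t0t; exists (Num.truncn ((t - t0) / T)).
have tT0 : 0 <= (t - t0) / T by rewrite divr_ge0 ?subr_ge0// ltW.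
rewrite /sampling_time -lerBrDl -ltrBlDl -ler_pdivlMr// -ltr_pdivrMr//.
exact: truncn_itv.
Qed.

End sampling.

Section closed_loop.
Context {R : realType} {n m : nat} (T r tau : R).
Context (f : 'rV[R]_n -> 'rV[R]_m -> 'rV[R]_n) (k : R -> 'rV[R]_n -> 'rV[R]_m).
Context (g : R -> R) (sigma : R -> R -> R).
Hypotheses (T_gt0 : 0 < T) (r_ge0 : 0 <= r) (tau_ge0 : 0 <= tau).
Hypotheses (f_lip : locally_lipschitz f) (f00 : f 0 0 = 0) (f_fc : forward_complete f).
Hypotheses (k_C1 : C1_halfspace k) (gK : class_K g).
Hypothesis k_le_g : forall (t : R) (x : 'rV[R]_n),
  0 <= t -> enorm (k t x) <= g (enorm x).
Hypothesis sigma_KL : class_KL sigma.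
Hypothesis k_stab : forall (t0 : R) (x0 : 'rV[R]_n), 0 <= t0 ->
  (exists x, ode_solution `[t0, +oo[ (fun t y => f y (k t y)) x /\ x t0 = x0) /\
  forall x, ode_solution `[t0, +oo[ (fun t y => f y (k t y)) x /\ x t0 = x0 ->
    forall t, t0 <= t -> enorm (x t) <= sigma (enorm x0) (t - t0).

Local Notation V := 'rV[R]_n.
Local Notation U := 'rV[R]_m.
Local Notation traj I u := (ode_solution I (fun t y => f y (u t))).

(** A solution on a bounded interval satisfies the same estimate, because it
    extends to a solution on a half-line. *)
Lemma closed_loop_decay (a b : R) (w : R -> V) : 0 <= a -> a <= b ->
  ode_solution `[a, b] (fun t y => f y (k t y)) w ->
  enorm (w b) <= sigma (enorm (w a)) (b - a).
Proof.
move=> a0 ab ws; have [[w2 [w2s w2b]] _] := k_stab (w b) (le_trans a0 ab).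
have [_ /(_ (fun t => if t <= b then w t else w2 t) _ b ab)] := k_stab (w a) a0.
rewrite lexx; apply; split; last by rewrite ab.
apply: ode_solution_glue _ _ (esym w2b) ws w2s => t /=; rewrite !in_itv/= !andbT//.
Qed.

Lemma sigma_le (s t t' : R) : 0 <= s -> 0 <= t -> t <= t' -> sigma s t' <= sigma s t.
Proof.
move=> s0 t0 tt'; have [_ _ /(_ s s0)[sm _]] := sigma_KL.
by apply: sm => //; rewrite in_itv/= andbT// (le_trans t0).
Qed.

Lemma sigmaK (t : R) : 0 <= t -> class_K (fun s => sigma s t).
Proof. by move=> t0; have [_ + _] := sigma_KL; exact. Qed.

Definition datum (x0 : R -> V) (z0 : V) (u0 : R -> U) : R :=
  enorm z0 + fine (sup_norm r x0) + fine (sup_norm (r + tau) u0).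

Lemma datumP (x0 : R -> V) (z0 : V) (u0 : R -> U) :
  {within `[- r, 0], continuous x0} -> Linfty `[- (r + tau), 0] u0 ->
  [/\ 0 <= datum x0 z0 u0, enorm z0 <= datum x0 z0 u0,
    forall th, - r <= th <= 0 -> enorm (x0 th) <= datum x0 z0 u0 &
    forall th, - (r + tau) <= th <= 0 -> enorm (u0 th) <= datum x0 z0 u0].
Proof.
move=> x0c [_ /bounded_onP[Mu uM]].
have [Mx _ xM] := continuous_bounded x0c.
have xs : forall th, - r <= th <= 0 -> enorm (x0 th) <= fine (sup_norm r x0).
  apply: (@le_sup_norm _ _ _ _ (n%:R * Mx)) => // th thr.
  by apply: le_trans (enorm_le_norm _) _; rewrite ler_wpM2l// xM.
have us : forall th, - (r + tau) <= th <= 0 -> enorm (u0 th) <= fine (sup_norm (r + tau) u0).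
  apply: (@le_sup_norm _ _ _ _ (m%:R * Mu)) => [|th thr]; first exact: addr_ge0.
  by apply: le_trans (enorm_le_norm _) _; rewrite ler_wpM2l// uM//= in_itv.
have x00 : 0 <= fine (sup_norm r x0).
  by apply: le_trans (enorm_ge0 _) (xs 0 _); rewrite oppr_le0 r_ge0 lexx.
have u00 : 0 <= fine (sup_norm (r + tau) u0).
  by apply: le_trans (enorm_ge0 _) (us 0 _); rewrite oppr_le0 addr_ge0// lexx.
have z00 := enorm_ge0 z0.
by rewrite /datum; split=> [|| th /xs| th /us]; lra.
Qed.

Section trajectory.
Context (t0 : R) (x0 : R -> V) (z0 : V) (u0 : R -> U) (x z : R -> V) (u : R -> U).
Hypothesis t0_ge0 : 0 <= t0.
Hypotheses (x0c : {within `[- r, 0], continuous x0}) (u0L : Linfty `[- (r + tau), 0] u0).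
Hypothesis sol : closed_loop_solution f k T r tau t0 x0 z0 u0 x z u.
Local Notation ti := (sampling_time T t0).

Let ti_ge i : t0 <= ti i.
Proof. by rewrite -[leLHS](sampling_time0 T); exact: sampling_time_le. Qed.

Let uK t : t0 < t -> u t = k (t + tau) (z t).
Proof. exact: (closed_loop_feedback sol). Qed.

Let tilt i : ti i < ti i.+1. Proof. by rewrite sampling_timeS ltrDl. Qed.

Lemma flow_segment i c : ti i <= c -> c < ti i.+1 -> traj `[ti i, c] u z.
Proof.
move=> ic ci; apply: ode_solutionS (closed_loop_flow sol i) => t /=.
by rewrite !in_itv/= => /andP[-> tc]; exact: le_lt_trans ci.
Qed.

Lemma flow_continuous i t : ti i < t < ti i.+1 -> {for t, continuous z}.
Proof.
move=> /andP[it ti1]; have [c tc ci] : exists2 c, t < c & c < ti i.+1.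
  by exists ((t + ti i.+1) / 2); lra.
apply: (ode_solution_continuous_at (flow_segment _ ci)); last by rewrite it.
by apply: ltW; exact: lt_trans tc.
Qed.

(** Delayed by [tau], the flow over one period is a solution of the nominal closed
    loop, however wrong the state from which the last sampling restarted it. *)
Lemma flow_decay i t : ti i <= t < ti i.+1 ->
  enorm (z t) <= sigma (enorm (z (ti i))) (t - ti i).
Proof.
move=> /andP[it ti1].
have := @closed_loop_decay (ti i + tau) (t + tau) (fun s => z (s - tau)).
rewrite !addrK lerD2r => /(_ _ it) H.
have -> : t - ti i = t + tau - (ti i + tau) by lra.
apply: H; first by rewrite addr_ge0// (le_trans t0_ge0).
have zs : traj `[ti i + tau - tau, t + tau - tau] u z by rewrite !addrK; exact: flow_segment.
have := traj_shift zs; apply: eq_ode_rhs (negligible1 (t0 + tau)) _ => s /=.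
rewrite in_itv/= => /andP[is_ st] ns; rewrite uK ?subrK//.
rewrite lt_neqAle; apply/andP; split; last by have := ti_ge i; lra.
by apply/eqP => ts; apply: ns; rewrite ts subrK.
Qed.

Lemma input_init t : t0 - (r + tau) <= t <= t0 -> u t = u0 (t - t0).
Proof.
move=> /andP[h1 h2]; rewrite -(closed_loop_init_u sol).
  by rewrite /history addrC subrK.
by rewrite in_itv/=; apply/andP; split; lra.
Qed.

Lemma plant_init t : t0 - r <= t <= t0 -> x t = x0 (t - t0).
Proof.
move=> /andP[h1 h2]; rewrite -(closed_loop_init_x sol).
  by rewrite /history addrC subrK.
by rewrite in_itv/=; apply/andP; split; lra.
Qed.

(** Period by period: inside each of them the flow is continuous, and so is the
    feedback. *)
Lemma input_measurable i : lebesgue_measurable_fun `[t0 - (r + tau), ti i] u.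
Proof.
elim: i => [|i IH].
  rewrite sampling_time0; apply: (@eq_lebesgue_measurable_fun _ _ _ (fun t => u0 (t - t0))).
    by move=> t /=; rewrite in_itv/= => /input_init.
  have := lebesgue_measurable_fun_shift (c := - t0) u0L.1.
  congr (lebesgue_measurable_fun _ _).
  by apply/seteqP; split => t /=; rewrite !in_itv/= => /andP[h1 h2]; apply/andP; split; lra.
have A0 : t0 - (r + tau) <= ti i.
  by apply: le_trans (ti_ge i); rewrite lerBlDr lerDl addr_ge0.
have -> : `[t0 - (r + tau), ti i.+1]%classic =
    `[t0 - (r + tau), ti i]%classic `|` (`]ti i, ti i.+1[%classic `|` [set ti i.+1]) :> set R.
  apply/seteqP; split => t /=; rewrite !in_itv/=.
    move=> /andP[h1]; rewrite le_eqVlt => /orP[/eqP ->|h2]; first by right; right.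
    by have [h3|h3] := leP t (ti i); [left; rewrite h1|right; left].
  move=> [/andP[-> h]|[/andP[h1 h2]|->]] /=.
  - exact: le_trans h (ltW (tilt i)).
  - by rewrite (le_trans A0)/= ltW.
  - by rewrite lexx andbT (le_trans A0)// ltW.
apply: lebesgue_measurable_funU IH _; first exact: lebesgue_measurable_itv.
  apply: measurableU; first exact: lebesgue_measurable_itv.
  by rewrite -set_itv1; exact: lebesgue_measurable_itv.
apply: lebesgue_measurable_funU.
- exact: lebesgue_measurable_itv.
- by rewrite -set_itv1; exact: lebesgue_measurable_itv.
- apply: (@eq_lebesgue_measurable_fun _ _ _ (fun t => k (t + tau) (z t))).
    by move=> t /=; rewrite in_itv/= => /andP[it _]; rewrite uK// (le_lt_trans (ti_ge i)).
  apply: feedback_measurable => //; first exact: le_trans (ti_ge i).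
  by move=> t; exact: flow_continuous.
- exact: lebesgue_measurable_fun1.
Qed.

(** * Bounds propagated through the sampling periods *)

Definition gain_on (beta : R -> R) (D : R) : Prop :=
  forall a b s (v : R -> U) (y : R -> V), a <= b -> b - a <= D -> admissible a b s v ->
    traj `[a, b] v y -> `|y a| <= s -> `|y b| <= beta s.

(** The input at the end of a period depends on the prediction made there, which
    is bounded through the input over the period; resetting that single value
    breaks the circle. *)
Lemma admissible_reset (a b M : R) (v : R -> U) : a <= b -> 0 <= M ->
  lebesgue_measurable_fun `[a, b] v -> (forall t, a <= t < b -> `|v t| <= M) ->
  admissible a b M (fun t => if t < b then v t else 0).
Proof.
move=> ab M0 mv vM; split; last first.
  by move=> t /andP[at_ tb]; case: ifPn => [tb'|_]; [rewrite vM// at_|rewrite normr0].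
have -> : `[a, b]%classic = (`[a, b[ `|` `[b, b])%classic :> set R.
  apply/seteqP; split => t /=; rewrite !in_itv/=.
    by move=> /andP[at_ tb]; have [h|h] := ltP t b; [left; rewrite at_|right].
  by move=> [/andP[h1 h2]|/andP[h1 h2]]; apply/andP; split; lra.
apply: lebesgue_measurable_funU.
- exact: lebesgue_measurable_itv.
- exact: lebesgue_measurable_itv.
- apply: (@eq_lebesgue_measurable_fun _ _ _ v).
    by move=> t /=; rewrite in_itv/= => /andP[_ ->].
  apply: lebesgue_measurable_funS (lebesgue_measurable_itv _) _ mv.
  by move=> t /=; rewrite !in_itv/= => /andP[-> /ltW].
- by rewrite set_itv1; exact: lebesgue_measurable_fun1.
Qed.

Lemma plant_le (beta : R -> R) (D b s : R) (v : R -> U) : gain_on beta D ->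
  admissible (t0 - (r + tau)) b s v ->
  (forall t, t0 - (r + tau) <= t < b -> u t = v t) ->
  b + tau - t0 <= D -> `|x t0| <= s -> forall t, t0 <= t <= b + tau -> `|x t| <= beta s.
Proof.
have [r0 tau0 t00] := And3 r_ge0 tau_ge0 t0_ge0.
move=> bD vs uv bt xs t /andP[t0t tb].
apply: (bD t0 t s (fun r => v (r - tau))) => //; first lra.
- apply: admissible_shift; apply: admissibleS vs; lra.
- apply: (eq_ode_rhs (negligible1 (b + tau)) _
    (ode_solutionS _ (closed_loop_plant sol))).
    move=> w /=; rewrite in_itv/= => /andP[h1 h2] wb; rewrite uv//.
    have : w != b + tau by apply/eqP.
    by rewrite neq_lt => /orP[h|h]; apply/andP; split; lra.
  by move=> w /=; rewrite !in_itv/= andbT => /andP[].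
Qed.

Lemma predictor_le (beta : R -> R) (D s : R) (p : V) (w v : R -> U) : gain_on beta D ->
  r + tau <= D -> admissible (- (r + tau)) 0 s v ->
  (forall t, - (r + tau) <= t < 0 -> w t = v t) -> `|p| <= s -> 0 <= beta s ->
  `|predictor f r tau p w| <= beta s.
Proof.
have [r0 tau0 t00] := And3 r_ge0 tau_ge0 t0_ge0.
move=> bD rD vs wv ps b0; rewrite /predictor.
(* [xget] returns 0 if the equation has no solution. *)
case: xgetP => [y _ [X [Xs Xp <-]]|_]; last by rewrite normr0.
apply: (bD (- r) tau s (fun t => v (t - tau))) => //; rewrite ?Xp//; [lra|lra|..].
- by apply: admissible_shift; apply: admissibleS vs; lra.
- apply: eq_ode_rhs (negligible1 tau) _ Xs => t /=.
  rewrite in_itv/= => /andP[h1 h2] tt; rewrite wv//.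
  have : t != tau by apply/eqP.
  by rewrite neq_lt => /orP[h|h]; apply/andP; split; lra.
Qed.

(** The plant is followed [tau] further, where it depends on the same inputs. *)
Definition bounded_until (i : nat) (c : R) : Prop :=
  [/\ forall t, t0 - (r + tau) <= t <= ti i -> enorm (u t) <= c,
      forall t, t0 <= t <= ti i -> enorm (z t) <= c &
      forall t, t0 - r <= t <= ti i + tau -> enorm (x t) <= c].

Let s0 := datum x0 z0 u0.

Let N1 : R := n.+1%:R.

Let enorm_le_N1 (v : V) c : `|v| <= c -> enorm v <= N1 * c.
Proof.
move=> vc; apply: le_trans (enorm_le_norm v) _.
by rewrite ler_pM// ?ler_nat.
Qed.

(** Up to time [t0 + tau] the plant is driven by the initial input alone. *)
Lemma bounded_until0 (beta : R -> R) (D : R) : class_K beta -> gain_on beta D ->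
  tau <= D -> bounded_until 0 (s0 + N1 * beta s0).
Proof.
have [r0 tau0 t00] := And3 r_ge0 tau_ge0 t0_ge0.
move=> bK bD tD; have [s00 zs xs us] := datumP z0 x0c u0L.
have b0 : 0 <= N1 * beta s0 by rewrite mulr_ge0// (class_K_ge0 bK).
rewrite /bounded_until sampling_time0.
have us' t : t0 - (r + tau) <= t <= t0 -> enorm (u t) <= s0.
  by move=> tr; rewrite input_init// us//; case/andP: tr => h1 h2; apply/andP; split; lra.
have xs' t : t0 - r <= t <= t0 -> enorm (x t) <= s0.
  by move=> tr; rewrite plant_init// xs//; case/andP: tr => h1 h2; apply/andP; split; lra.
split=> t.
- by move=> /us'; rewrite -/s0; lra.
- move=> tt; have -> : t = t0 by apply/eqP; rewrite eq_le andbC.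
  by rewrite (closed_loop_init_z sol); rewrite -/s0 in zs; lra.
- move=> /andP[h1 h2]; have [h|h] := leP t t0.
    by have := xs' t; rewrite h1 h => /(_ isT); lra.
  rewrite -[leLHS]add0r lerD//; apply: enorm_le_N1.
  apply: (plant_le bD (b := t0) (v := u)) => //; last 2 first.
  + by apply: le_trans (norm_le_enorm _) (xs' _ _); rewrite lexx andbT; lra.
  + by rewrite h2 ltW.
  + split; last by move=> w wr; apply: le_trans (norm_le_enorm _) (us' _ wr).
    by have := input_measurable (i := 0); rewrite sampling_time0.
  + by rewrite addrAC subrr add0r.
Qed.

(** Over one period the bounds follow the flow of information: [z] by the nominal
    estimate, hence [u] by [g], hence [x] by the gain of the plant, hence the
    prediction that restarts [z] by the same gain, hence the input at that time. *)
Lemma bounded_untilS (beta : R -> R) (D : R) (i : nat) (c : R) :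
  class_K beta -> gain_on beta D -> ti i.+1 - t0 + r + tau <= D -> 0 <= c ->
  let a := c + g (sigma c 0) in
  let X := c + N1 * beta a in
  let Z := N1 * beta (X + a) in
  bounded_until i c -> bounded_until i.+1 (sigma c 0 + X + Z + a + g Z).
Proof.
have [r0 tau0 t00] := And3 r_ge0 tau_ge0 t0_ge0.
move=> bK bD iD c0 a X Z [uc zc xc].
have g0 := class_K_ge0 gK; have b0 := class_K_ge0 bK.
have sg0 : 0 <= sigma c 0 by apply: (class_K_ge0 (sigmaK (lexx 0))).
have gs0 : 0 <= g (sigma c 0) by exact: g0.
have a0 : 0 <= a by rewrite addr_ge0.
have ba0 : 0 <= N1 * beta a by rewrite mulr_ge0// b0.
have X0 : 0 <= X by rewrite addr_ge0.
have Z0 : 0 <= Z by rewrite mulr_ge0// b0// addr_ge0.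
have gZ0 : 0 <= g Z by exact: g0.
have it := tilt i; have i0 := ti_ge i.
have z1 t : ti i <= t < ti i.+1 -> enorm (z t) <= sigma c 0.
  move=> /[dup] itt /flow_decay/le_trans; apply.
  have zi : enorm (z (ti i)) <= c by apply: zc; rewrite lexx andbT.
  apply: le_trans (class_K_le (sigmaK (lexx 0)) (enorm_ge0 _) zi).
  by apply: sigma_le => //; [exact: enorm_ge0|case/andP: itt; rewrite subr_ge0].
have u1 t : t0 - (r + tau) <= t < ti i.+1 -> enorm (u t) <= a.
  move=> /andP[h1 h2]; have [h|h] := leP t (ti i).
    by apply: le_trans (uc t _) _; rewrite ?h1// lerDl.
  rewrite uK; last exact: le_lt_trans h.
  apply: le_trans (k_le_g _ _) _; first by lra.
  apply: le_trans (class_K_le gK (enorm_ge0 _) (z1 t _)) _; first by rewrite (ltW h).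
  by rewrite lerDr.
pose v t := if t < ti i.+1 then u t else 0.
have va : admissible (t0 - (r + tau)) (ti i.+1) a v.
  apply: admissible_reset; [lra|exact: a0|exact: input_measurable|].
  by move=> t tr; apply: le_trans (norm_le_enorm _) (u1 t tr).
have uv t : t0 - (r + tau) <= t < ti i.+1 -> u t = v t by move=> /andP[_ h]; rewrite /v h.
have x1 t : t0 - r <= t <= ti i.+1 + tau -> enorm (x t) <= X.
  move=> /andP[h1 h2]; have [h|h] := leP t t0.
    by apply: le_trans (xc t _) _; [rewrite h1; lra|rewrite lerDl].
  rewrite -[leLHS]add0r lerD//; apply: enorm_le_N1.
  apply: (plant_le bD va uv); last by rewrite ltW.
    by lra.
  apply: le_trans (norm_le_enorm _) _; apply: le_trans (xc _ _) _; last by rewrite lerDl.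
  by apply/andP; split; lra.
have zS : enorm (z (ti i.+1)) <= Z.
  rewrite (closed_loop_jump sol); apply: enorm_le_N1.
  apply: (predictor_le bD (v := fun t => v (t + ti i.+1))).
  - lra.
  - apply: admissible_shift; rewrite add0r; apply: (admissibleS _ (lexx _)).
      2: by split; [exact: va.1|move=> t /va.2 h; apply: le_trans h _; rewrite lerDr].
    by lra.
  - by move=> t /andP[h1 h2]; rewrite /history addrC uv//; apply/andP; split; lra.
  - apply: le_trans (norm_le_enorm _) _; apply: le_trans (x1 _ _) _; last by rewrite lerDl.
    by apply/andP; split; lra.
  - by apply: b0; rewrite addr_ge0.
split=> t.
- move=> /andP[h1]; rewrite le_eqVlt => /orP[/eqP->|h2]; last first.
    by have := u1 t; rewrite h1 h2 => /(_ isT); lra.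
  rewrite uK; last by lra.
  have := class_K_le gK (enorm_ge0 _) zS.
  have := k_le_g (t := ti i.+1 + tau) (z (ti i.+1)); lra.
- move=> /andP[h1]; rewrite le_eqVlt => /orP[/eqP->|h2]; first by lra.
  have [h|h] := leP t (ti i); last first.
    by have := z1 t; rewrite (ltW h) h2 => /(_ isT); lra.
  by have := zc t; rewrite h1 h => /(_ isT); rewrite /a; lra.
- by move=> /x1; lra.
Qed.

(** * Exactness of the predictor and decay *)

(** When the delayed measurement was taken after [t0], the plant itself solves the
    equation that defines the prediction. *)
Lemma predictor_exact (i : nat) (c : R) : bounded_until i.+1 c -> t0 + r <= ti i.+1 ->
  z (ti i.+1) = x (ti i.+1 + tau).
Proof.
have [r0 tau0 t00] := And3 r_ge0 tau_ge0 t0_ge0.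
move=> [uc _ _] ri; rewrite (closed_loop_jump sol) /predictor.
set P := (X in xget _ X).
have Xs : ode_solution `[- r, tau]
    (fun t p => f p (history (ti i.+1) u (t - tau))) (fun s => x (s + ti i.+1)).
  have xs : traj `[- r + ti i.+1, tau + ti i.+1] (fun t => u (t - tau)) x.
    apply: ode_solutionS (closed_loop_plant sol) => t /=.
    by rewrite !in_itv/= andbT => /andP[h1 _]; lra.
  have := traj_shift xs; apply: eq_ode_rhs (negligible_set0 _) _ => t _ _.
  by rewrite /history; congr (f _ (u _)); lra.
have Px : P (x (tau + ti i.+1)).
  by exists (fun s => x (s + ti i.+1)); split => //; rewrite addrC.
have [X' [X's X'r <-]] : P (xget 0 P) by exact: (xgetI _ Px).
rewrite addrC; apply: (traj_unique f_lip (M := c) _ X's Xs).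
- move=> t /andP[h1 h2]; apply: le_trans (norm_le_enorm _) (uc _ _).
  by apply/andP; split; lra.
- by rewrite X'r addrC.
- by rewrite lexx andbT; lra.
Qed.

Lemma flow_exact (i : nat) (c t : R) : bounded_until i.+2 c -> t0 + r <= ti i.+1 ->
  ti i.+1 <= t < ti i.+2 -> z t = x (t + tau).
Proof.
have [r0 tau0 t00] := And3 r_ge0 tau_ge0 t0_ge0.
move=> [uc zc xc] ri /andP[it ti2]; have i0 := ti_ge i.+1.
have zs := flow_segment it ti2.
have xs : traj `[ti i.+1 + tau, t + tau] (fun s => u (s - tau)) x.
  apply: ode_solutionS (closed_loop_plant sol) => s /=.
  by rewrite !in_itv/= andbT => /andP[h1 _]; lra.
have {}xs : traj `[ti i.+1, t] u (fun s => x (s + tau)).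
  have := traj_shift xs; apply: eq_ode_rhs (negligible_set0 _) _ => s _ _.
  by rewrite addrK.
have h := tilt i.+1.
apply: (traj_unique f_lip (M := c) _ zs xs).
- move=> s /andP[h1 h2]; apply: le_trans (norm_le_enorm _) (uc _ _).
  by apply/andP; split; lra.
- apply: (@predictor_exact _ c) => //; split=> s /andP[h1 h2];
    [apply: uc|apply: zc|apply: xc]; apply/andP; split; lra.
- by rewrite it lexx.
Qed.

(** From then on [z] anticipates the plant by [tau], so that the delayed input
    is the nominal feedback. *)
Lemma plant_decay (i : nat) : (forall j, exists c, bounded_until j c) ->
  t0 + r <= ti i.+1 -> forall t, ti i.+1 <= t -> z t = x (t + tau) /\
  enorm (x (t + tau)) <= sigma (enorm (x (ti i.+1 + tau))) (t - ti i.+1).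
Proof.
have [r0 tau0 t00] := And3 r_ge0 tau_ge0 t0_ge0.
move=> bnd ri t it; have i0 := ti_ge i; have h := tilt i.
have zx s : ti i.+1 <= s -> z s = x (s + tau).
  move=> is_; have [|j /andP[js sj]] := @sampling_index _ T t0 T_gt0 s; first by lra.
  have ij : (i.+1 <= j)%N.
    by rewrite leqNgt; apply/negP => /(sampling_time_le t0 T_gt0); lra.
  case: j ij js sj => // j ij js sj; have [c bc] := bnd j.+2.
  apply: (flow_exact bc); last by rewrite js.
  by have := sampling_time_le t0 T_gt0 ij; lra.
split; first exact: zx.
have pos : 0 <= ti i.+1 + tau by lra.
have -> : t - ti i.+1 = t + tau - (ti i.+1 + tau) by lra.
apply: (k_stab (x (ti i.+1 + tau)) pos).2; last by lra.
split=> //.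
have xs : ode_solution `[ti i.+1 + tau, +oo[ (fun t y => f y (u (t - tau))) x.
  apply: ode_solutionS (closed_loop_plant sol) => s /=.
  by rewrite !in_itv/= !andbT; lra.
apply: eq_ode_rhs (negligible_set0 _) _ xs => s /=.
rewrite in_itv/= andbT => ss _; congr (f _ _).
rewrite uK; last by lra.
by rewrite zx; [rewrite subrK|lra].
Qed.

End trajectory.

(** The bounds of [bounded_untilS] are compositions of class K functions of the
    size of the data, so they are of class K, and uniform in the data. *)
Lemma uniform_bound (i : nat) : exists2 G : R -> R, class_K G &
  forall (t0 : R) (x0 : R -> V) z0 u0 x z u, 0 <= t0 ->
    {within `[- r, 0], continuous x0} -> Linfty `[- (r + tau), 0] u0 ->
    closed_loop_solution f k T r tau t0 x0 z0 u0 x z u ->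
    bounded_until t0 x z u i (G (datum x0 z0 u0)).
Proof.
have [r0 tau0] := conj r_ge0 tau_ge0.
have D0 : 0 <= i%:R * T + r + tau by rewrite !addr_ge0// mulr_ge0// ltW.
have N0 : 0 < n.+1%:R :> R by [].
elim: i D0 => [|i IH] D0; have [beta bK bD] := reachable_class_K f_lip f_fc f00 D0.
  exists (fun s => s + n.+1%:R * beta s).
    by apply: class_KD; [exact: class_K_id|exact: class_K_scale].
  move=> t0 x0 z0 u0 x z u t00 x0c u0L sol.
  by apply: (bounded_until0 t00 x0c u0L sol bK bD); rewrite mul0r add0r; lra.
have [|G GK GP] := IH _.
  by rewrite !addr_ge0// mulr_ge0// ltW.
pose a s := G s + g (sigma (G s) 0).
pose X s := G s + n.+1%:R * beta (a s).
pose Z s := n.+1%:R * beta (X s + a s).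
have s0K : class_K (fun s => sigma (G s) 0) := class_K_comp (sigmaK (lexx 0)) GK.
have aK : class_K a by apply: class_KD => //; exact: (class_K_comp gK s0K).
have XK : class_K X.
  by apply: class_KD => //; apply: class_K_scale => //; exact: (class_K_comp bK aK).
have ZK : class_K Z.
  by apply: class_K_scale => //; exact: (class_K_comp bK (class_KD XK aK)).
exists (fun s => sigma (G s) 0 + X s + Z s + a s + g (Z s)).
  apply: class_KD; last exact: (class_K_comp gK ZK).
  by do 3 ![apply: class_KD => //].
move=> t0 x0 z0 u0 x z u t00 x0c u0L sol.
apply: (bounded_untilS t00 u0L sol bK bD).
- by rewrite /sampling_time [t0 + _]addrC addrK.
- by apply: (class_K_ge0 GK); have [] := datumP z0 x0c u0L.
- exact: (GP _ _ _ _ _ _ _ t00 x0c u0L sol).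
Qed.

(** From the first sampling time later than [t0 + r] on, the nominal decay
    applies to the plant; the histories see only such times once a further
    [r + tau] has elapsed, and the uniform bound covers what comes before. *)
Lemma closed_loop_stability : exists2 sigma' : R -> R -> R, class_KL sigma' &
  forall (t0 : R) (x0 : R -> V) z0 u0 x z u, 0 <= t0 ->
    {within `[- r, 0], continuous x0} -> Linfty `[- (r + tau), 0] u0 ->
    closed_loop_solution f k T r tau t0 x0 z0 u0 x z u -> forall t : R, t0 <= t ->
      ((enorm (z t))%:E + sup_norm r (history t x) + sup_norm (r + tau) (history t u)
        <= (sigma' (datum x0 z0 u0) (t - t0))%:E)%E.
Proof.
have [r0 tau0] := conj r_ge0 tau_ge0.
(* The predictor is exact from the sampling time of index [i.+1] on; [l] more
   periods cover the length of the histories. *)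
pose i := Num.truncn (r / T); pose l := (Num.truncn ((r + tau) / T)).+1.
have iT : r < i.+1%:R * T by rewrite -ltr_pdivrMr// truncnS_gt.
have lT : r + tau < l%:R * T by rewrite -ltr_pdivrMr// truncnS_gt.
have [G GK GP] := uniform_bound (i.+1 + l).
pose S := i.+1%:R * T + (r + tau).
have S0 : 0 <= S by rewrite /S; lra.
pose H s := G s + G s + G s.
have HK : class_K H by do 2 ![apply: class_KD => //].
pose h y := y + y + g y.
have hK : class_K h by do 2 ![apply: class_KD => //]; exact: class_K_id.
have [sigma' sK [early late]] := class_KL_delay HK hK sigma_KL S0.
exists sigma' => // t0 x0 z0 u0 x z u t00 x0c u0L sol t t0t.
have [s0 _ _ _] := datumP z0 x0c u0L; set s := datum x0 z0 u0 in s0 *.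
have G0 : 0 <= G s by exact: (class_K_ge0 GK).
have [uc zc xc] := GP _ _ _ _ _ _ _ t00 x0c u0L sol; rewrite -/s in uc zc xc.
pose ti := sampling_time T t0.
have tlE : ti (i.+1 + l)%N = t0 + i.+1%:R * T + l%:R * T.
  by rewrite /ti /sampling_time natrD mulrDl addrA.
have tiE : ti i.+1 = t0 + i.+1%:R * T by [].
rewrite -/ti tlE in uc zc xc.
have sum_le (c : R) cz cx cu : enorm (z t) <= cz ->
    (forall th, - r <= th <= 0 -> enorm (x (t + th)) <= cx) ->
    (forall th, - (r + tau) <= th <= 0 -> enorm (u (t + th)) <= cu) ->
    cz + cx + cu <= c ->
    ((enorm (z t))%:E + sup_norm r (history t x) + sup_norm (r + tau) (history t u)
      <= c%:E)%E.
  move=> hz hx hu hc; apply: (@le_trans _ _ (cz + cx + cu)%:E); last by rewrite lee_fin.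
  rewrite !EFinD; apply: leeD; last exact: sup_norm_le.
  by apply: leeD; [rewrite lee_fin|exact: sup_norm_le].
have [tS|St] := leP (t - t0) S.
  apply: (sum_le _ (G s) (G s) (G s)); last by apply: early => //; rewrite subr_ge0.
  - by apply: zc; rewrite t0t/=; rewrite /S in tS; lra.
  - by move=> th /andP[h1 h2]; apply: xc; apply/andP; rewrite /S in tS; split; lra.
  - by move=> th /andP[h1 h2]; apply: uc; apply/andP; rewrite /S in tS; split; lra.
have bnd j : exists c, bounded_until t0 x z u j c.
  by have [Gj _ GjP] := uniform_bound j; exists (Gj s); exact: (GjP _ _ _ _ _ _ _ t00 x0c u0L sol).
have ri : t0 + r <= ti i.+1 by rewrite tiE; lra.
have dec := plant_decay t00 sol bnd ri; rewrite -/ti in dec.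
have xi : enorm (x (ti i.+1 + tau)) <= H s.
  apply: (@le_trans _ _ (G s)); last by rewrite /H; lra.
  by apply: xc; rewrite tiE; apply/andP; split; lra.
pose c := sigma (H s) (t - t0 - S).
have H0 : 0 <= H s by rewrite /H; lra.
have xdec t' : ti i.+1 <= t' -> t - (r + tau) <= t' -> enorm (x (t' + tau)) <= c.
  move=> it' tt'; have [_ /le_trans] := dec t' it'; apply.
  have t'0 : 0 <= t' - ti i.+1 by lra.
  apply: le_trans (class_K_le (sigmaK t'0) (enorm_ge0 _) xi) _.
  by apply: sigma_le => //; [lra|rewrite tiE /S; lra].
have iS : ti i.+1 <= t - (r + tau) by rewrite tiE; rewrite /S in St; lra.
have zdec t' : t - (r + tau) <= t' -> enorm (z t') <= c.
  by move=> tt'; rewrite (dec t' _).1 ?xdec//; lra.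
apply: (sum_le _ c c (g c)); last exact: late s0 (ltW St).
- by apply: zdec; lra.
- move=> th /andP[h1 h2]; have -> : t + th = t + th - tau + tau by rewrite subrK.
  by apply: xdec; lra.
- move=> th /andP[h1 h2]; rewrite (closed_loop_feedback sol); last by lra.
  apply: le_trans (k_le_g _ _) _; first by lra.
  by apply: (class_K_le gK (enorm_ge0 _)); apply: zdec; lra.
Qed.

(** * Existence of closed-loop solutions *)

Lemma lebesgue_measurable_closure (a b : R) (v : R -> U) : a <= b ->
  lebesgue_measurable_fun `]a, b[ v -> lebesgue_measurable_fun `[a, b] v.
Proof.
move=> ab mv; have -> : `[a, b]%classic = (`[a, a] `|` `]a, b[ `|` `[b, b])%classic :> set R.
  apply/seteqP; split => t /=; rewrite !in_itv/=.
    have [->|ta] := eqVneq t a; first by left; left; rewrite lexx.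
    have [->|tb] := eqVneq t b; first by right; rewrite lexx.
    by move=> /andP[h1 h2]; left; right; rewrite !lt_neqAle h1 h2 eq_sym ta tb.
  by move=> [[/andP[h1 h2]|/andP[h1 h2]]|/andP[h1 h2]]; apply/andP; split; lra.
apply: lebesgue_measurable_funU.
- by apply: measurableU; exact: lebesgue_measurable_itv.
- exact: lebesgue_measurable_itv.
- apply: lebesgue_measurable_funU mv.
  + exact: lebesgue_measurable_itv.
  + exact: lebesgue_measurable_itv.
  + by rewrite set_itv1; exact: lebesgue_measurable_fun1.
- by rewrite set_itv1; exact: lebesgue_measurable_fun1.
Qed.

Lemma feedback_admissible (a b : R) (F : R -> V -> V) (w : R -> V) : 0 <= a -> a <= b ->
  ode_solution `[a + tau, +oo[ F w ->
  exists M, admissible a b M (fun t => k (t + tau) (w (t + tau))).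
Proof.
have tau0 := tau_ge0; move=> a0 ab ws.
have ws' : ode_solution `[a, b] (fun t => F (t + tau)) (fun t => w (t + tau)).
  apply: ode_solutionS (ode_solution_shift tau ws) => t /=.
  by rewrite !in_itv/= andbT => /andP[h _]; rewrite lerD2r.
have [B B0 wB] := continuous_bounded (ode_solution_continuous ws').
exists (g (n%:R * B)); split.
  apply: lebesgue_measurable_closure ab _.
  apply: (feedback_measurable k_C1 tau_ge0 a0) => t.
  exact: (ode_solution_continuous_at ws').
move=> t /[dup] tab /andP[at_ _]; apply: le_trans (norm_le_enorm _) _.
apply: le_trans (k_le_g _ _) _; first by lra.
apply: (class_K_le gK (enorm_ge0 _)); apply: le_trans (enorm_le_norm _) _.
by rewrite ler_wpM2l// wB.
Qed.

Definition locally_admissible (a : R) (v : R -> U) : Prop :=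
  forall b, exists M, admissible a b M v.

Lemma locally_admissible_Linfty (a : R) (v : R -> U) : locally_admissible a v ->
  Linfty_loc `[a, +oo[ v.
Proof.
move=> va; split; last first.
  move=> c d cd; apply/bounded_onP; have [M [_ vM]] := va d.
  exists M => t tcd; apply: vM; have := cd t tcd; rewrite /= in_itv/= andbT => ->.
  by move: tcd; rewrite /= in_itv/= => /andP[].
have -> : `[a, +oo[%classic = \bigcup_N `[a, a + N%:R]%classic :> set R.
  apply/seteqP; split => t /=; rewrite in_itv/= andbT.
    move=> at_; exists (Num.truncn (t - a)).+1 => //=; rewrite in_itv/= at_/=.
    by have := truncnS_gt (t - a); lra.
  by move=> [N _ /=]; rewrite in_itv/= => /andP[].
move=> j; apply/measurable_fun_bigcup; first by move=> N; exact: lebesgue_measurable_itv.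
by move=> N; have [M [mv _]] := va (a + N%:R); exact: mv.
Qed.

Lemma admissibleW (a b M M' : R) (v : R -> U) : M <= M' ->
  admissible a b M v -> admissible a b M' v.
Proof. by move=> MM' [mv vM]; split => // t /vM/le_trans; apply. Qed.

Lemma eq_admissible (a b M : R) (v w : R -> U) : (forall t, a <= t <= b -> v t = w t) ->
  admissible a b M v -> admissible a b M w.
Proof.
move=> vw [mv vM]; split; last by move=> t tab; rewrite -vw// vM.
by apply: eq_lebesgue_measurable_fun mv => t /=; rewrite in_itv/= => /vw.
Qed.

Lemma locally_admissible_glue (a c M : R) (v w : R -> U) : a <= c ->
  admissible a c M v -> locally_admissible c w ->
  locally_admissible a (fun t => if t < c then v t else w t).
Proof.
move=> ac v1 wc b; pose b' := Num.max b c; have [M2 w2] := wc b'.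
exists (Num.max M M2); apply: (admissibleS (lexx a) (_ : b <= b')).
  by rewrite le_max lexx.
apply: admissible_glue => //; first by rewrite le_max lexx orbT.
- by apply: admissibleW v1; rewrite le_max lexx.
- by apply: admissibleW w2; rewrite le_max lexx orbT.
Qed.

Lemma eq_predictor (p : V) (v w : R -> U) (E : set R) :
  (@lebesgue_measure R).-negligible E ->
  (forall t, - r <= t <= tau -> ~ E t -> v (t - tau) = w (t - tau)) ->
  predictor f r tau p v = predictor f r tau p w.
Proof.
move=> E0 vw; rewrite /predictor; congr (xget _ _); apply/seteqP; split => y /= [X [Xs Xp Xy]];
  exists X; split => //; apply: eq_ode_rhs E0 _ Xs => t /=; rewrite in_itv/= => tr nE;
  by rewrite vw.
Qed.

(** Delayed by [tau], the flow over a period solves the nominal closed loop, which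
    has global solutions; so the input over the period is determined by the
    state from which [z] restarts, and the plant and the next prediction only
    depend on the input before the next sampling time. *)
Section existence.
Context (t0 : R) (x0 : R -> V) (z0 : V) (u0 : R -> U).
Hypothesis t0_ge0 : 0 <= t0.
Hypotheses (rtau_gt0 : 0 < r + tau) (u0L : Linfty `[- (r + tau), 0] u0).
Local Notation ti := (sampling_time T t0).
Let A := t0 - (r + tau).

Let plant (v : R -> U) : R -> V :=
  xget (fun=> 0) [set X | traj `[t0, +oo[ (fun t => v (t - tau)) X /\ X t0 = x0 0].

Let plantP v : locally_admissible A v ->
  traj `[t0, +oo[ (fun t => v (t - tau)) (plant v) /\ plant v t0 = x0 0.
Proof.
have [r0 tau0] := conj r_ge0 tau_ge0.
move=> vA; have [|X XP] := @traj_exists_infty _ _ _ f t0 (fun t => v (t - tau)) (x0 0) f_fc.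
  apply: locally_admissible_Linfty => b; have [M vM] := vA (b - tau).
  exists M; apply: (admissible_shift (c := - tau)).
  by apply: admissibleS vM; rewrite /A; lra.
exact: (xgetI _ (XP : [set X | _] X)).
Qed.

Let past_plant (v : R -> U) (t : R) : V :=
  if t <= t0 then x0 (t - t0) else plant v t.

Let restart (v : R -> U) (i : nat) : V :=
  if i is i'.+1 then predictor f r tau (past_plant v (ti i - r)) (history (ti i) v)
  else z0.

Let nominal (s : R) (p : V) : R -> V :=
  xget (fun=> 0) [set w | ode_solution `[s, +oo[ (fun t y => f y (k t y)) w /\ w s = p].

Let nominalP s p : 0 <= s ->
  ode_solution `[s, +oo[ (fun t y => f y (k t y)) (nominal s p) /\ nominal s p s = p.
Proof.
by move=> s_; have [[w wP] _] := k_stab p s_; exact: (xgetI _ (wP : [set w | _] w)).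
Qed.

(** After [ti i] the approximation of index [i.+1] carries on with the feedback of
    the current period for ever; it is the input of the solution up to [ti i.+1]
    only. *)
Let Fixpoint input (i : nat) {struct i} : R -> U :=
  if i is i'.+1 then fun t => if t < ti i' then input i' t
    else k (t + tau) (nominal (ti i' + tau) (restart (input i') i') (t + tau))
  else fun t => if t < t0 then u0 (t - t0) else 0.

Let flow (i : nat) : R -> V := nominal (ti i + tau) (restart (input i) i).

Let ti_ge i : t0 <= ti i.
Proof. by rewrite -[leLHS](sampling_time0 T); exact: sampling_time_le. Qed.

Let AleT0 : A <= t0.
Proof. by rewrite /A lerBlDr lerDl ltW. Qed.

Let ti0 i : 0 <= ti i + tau.
Proof. by rewrite addr_ge0// (le_trans t0_ge0). Qed.

Let input_admissible i : locally_admissible A (input i).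
Proof.
elim: i => [|i IH] /=.
  have [mu0 /bounded_onP[M uM]] := u0L.
  have u0A : admissible A t0 M (fun t => u0 (t - t0)).
    apply: (admissible_shift (c := - t0)).
    have -> : A - t0 = - (r + tau) by rewrite /A; lra.
    by rewrite subrr; split => // t tr; apply: uM; rewrite /= in_itv.
  apply: (locally_admissible_glue AleT0 u0A) => b.
  exists 0; split; first exact: lebesgue_measurable_fun_cst.
  by move=> t _; rewrite normr0.
have [M iM] := IH (ti i).
apply: (locally_admissible_glue _ iM) => [|b]; first exact: le_trans (ti_ge i).
pose b' := Num.max b (ti i).
have [ws _] := nominalP (restart (input i) i) (ti0 i).
have [|M' wM] := @feedback_admissible (ti i) b' _ _ (le_trans t0_ge0 (ti_ge i)) _ ws.
  by rewrite le_max lexx orbT.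
by exists M'; apply: admissibleS wM; rewrite ?lexx// le_max lexx.
Qed.

Let input_stable i j t : (i <= j)%N -> t < ti i -> input j t = input i t.
Proof.
move=> ij ti_; rewrite -(subnKC ij); elim: (j - i)%N => [|d IH].
  by rewrite addn0.
rewrite addnS /= ifT//; apply: lt_le_trans ti_ _.
by apply: sampling_time_le => //; exact: leq_addr.
Qed.

Let period (t : R) : nat := Num.truncn ((t - t0) / T).

Let period_gt t : t < ti (period t).+1.
Proof. by rewrite /sampling_time -ltrBlDl -ltr_pdivrMr// truncnS_gt. Qed.

Let period_le t : t0 <= t -> ti (period t) <= t.
Proof.
move=> t0t; rewrite /sampling_time -lerBrDl -ler_pdivlMr//.
by rewrite truncn_le// divr_ge0 ?subr_ge0// ltW.
Qed.

Let periodE i t : ti i <= t < ti i.+1 -> period t = i.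
Proof.
move=> /andP[it ti1]; have t0t := le_trans (ti_ge i) it.
have h1 := period_gt t; have h2 := period_le t0t.
apply/eqP; rewrite eqn_leq; apply/andP; split; rewrite -ltnS ltnNge;
  apply/negP => /(sampling_time_le t0 T_gt0); lra.
Qed.

Let v (t : R) : U := input (period t).+1 t.

Let vE i t : t < ti i -> v t = input i t.
Proof.
move=> tti; have h := period_gt t.
have [le|/ltnW le] := leqP i (period t).+1; first exact: input_stable.
by rewrite /v (input_stable le).
Qed.

Let v_admissible : locally_admissible A v.
Proof.
move=> b; have h := period_gt b.
have [M iM] := input_admissible (period b).+1 b; exists M.
by apply: eq_admissible iM => t /andP[_ tb]; rewrite (vE (le_lt_trans tb h)).
Qed.

Let v_past t : t < t0 -> v t = u0 (t - t0).
Proof. by move=> tt0; rewrite (vE (i := 0)) ?sampling_time0//= tt0. Qed.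

Let v_feedback t : t0 <= t -> v t = k (t + tau) (flow (period t) (t + tau)).
Proof. by move=> /period_le h; rewrite /v /= ltNge h. Qed.

Let u (t : R) : U := if t <= t0 then u0 (t - t0) else v t.

Let uE t : t <> t0 -> u t = v t.
Proof.
move=> /eqP; rewrite neq_lt /u => /orP[h|h]; first by rewrite (ltW h) v_past.
by rewrite leNgt h.
Qed.

Let flow0 i : flow i (ti i + tau) = restart (input i) i.
Proof. by have [] := nominalP (restart (input i) i) (ti0 i). Qed.

Lemma closed_loop_exists : exists x z w,
  closed_loop_solution f k T r tau t0 x0 z0 u0 x z w.
Proof.
have [r0 tau0 t00] := And3 r_ge0 tau_ge0 t0_ge0.
have [vs vs0] := plantP v_admissible.
pose z t := flow (period t) (t + tau).
exists (past_plant v), z, u; split.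
- apply: (eq_ode_solution (negligibleU (negligible1 t0) (negligible1 (t0 + tau))) _ _ _ vs).
  + move=> t; rewrite /= in_itv/= andbT /past_plant => t0t.
    case: ifPn => // tt0; have -> : t = t0 by apply/eqP; rewrite eq_le t0t tt0.
    by rewrite subrr.
  (* At [t0] the two-sided derivative also sees the initial history. *)
  + move=> t; rewrite /= in_itv/= andbT => t0t /not_orP[/= /eqP tt0 _].
    have {}t0t : t0 < t by rewrite lt_neqAle eq_sym tt0.
    by near=> s; rewrite /= in_itv/= andbT ltW//; near: s; exact: lt_nbhsr.
  + move=> t _ /not_orP[_ /= tt]; rewrite uE//.
    by move=> h; apply: tt; rewrite -h subrK.
- move=> i; have [ws _] := nominalP (restart (input i) i) (ti0 i).
  have it : ti i < ti i.+1 by rewrite sampling_timeS ltrDl.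
  have ws' : ode_solution `[ti i, ti i.+1[ (fun t y => f y (k (t + tau) y))
      (fun t => flow i (t + tau)).
    apply: ode_solutionS (ode_solution_shift tau ws) => t /=.
    by rewrite !in_itv/= andbT => /andP[h _]; rewrite lerD2r.
  have zE t : ti i <= t < ti i.+1 -> flow i (t + tau) = z t.
    by move=> /periodE; rewrite /z => ->.
  apply: (eq_ode_solution (negligible1 (ti i)) _ _ _ ws') => t; rewrite /= in_itv/=.
  + exact: zE.
  + move=> /andP[h1 h2] nt.
    have {}h1 : ti i < t by rewrite lt_neqAle h1 andbT; apply/eqP => h; apply: nt.
    near=> s; rewrite /= in_itv/=; apply/andP; split; last by near: s; exact: lt_nbhsl.
    by rewrite ltW//; near: s; exact: lt_nbhsr.
  + move=> /[dup] tr /andP[h1 h2] nt; have i0 := ti_ge i.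
    have tt0 : t0 <> t by move=> h; apply: nt => /=; lra.
    by rewrite uE ?v_feedback ?(le_trans i0)// ?(periodE tr)//; exact: nesym.
- move=> i; rewrite {1}/z (periodE (i := i.+1)); last first.
    by rewrite lexx [ti i.+2]sampling_timeS ltrDl.
  rewrite flow0 /=.
  have xE : past_plant (input i.+1) (ti i.+1 - r) = past_plant v (ti i.+1 - r).
    rewrite /past_plant; case: ifPn => //; rewrite -ltNge => h.
    have [is_ is0] := plantP (input_admissible i.+1).
    have sub : `[t0, ti i.+1 - r]%classic `<=` `[t0, +oo[%classic.
      by move=> t /=; rewrite !in_itv/= andbT => /andP[].
    have [M [_ vM]] := v_admissible (ti i.+1 - r - tau).
    apply: (traj_unique f_lip (u := fun t => v (t - tau)) (M := M) (a := t0)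
      (b := ti i.+1 - r) _ _ (ode_solutionS sub vs)).
    - by move=> t /andP[h1 h2]; apply: vM; rewrite /A; apply/andP; split; lra.
    - apply: eq_ode_rhs (negligible_set0 _) _ (ode_solutionS sub is_) => t.
      rewrite /= in_itv/= => /andP[_ tr] _; rewrite (vE (i := i.+1))//.
      by have := rtau_gt0; lra.
    - by rewrite is0 vs0.
    - by rewrite lexx andbT ltW.
  rewrite -[past_plant v _]xE.
  apply: (eq_predictor _ (negligibleU (negligible1 tau) (negligible1 (t0 - ti i.+1 + tau)))).
  move=> t /andP[h1 h2] /not_orP[/= /eqP n1 n2].
  rewrite /history uE; last by move=> h; apply: n2; rewrite /=; lra.
  rewrite (vE (i := i.+1))//; have : t < tau by rewrite lt_neqAle n1.
  by lra.
- by move=> t t0t; rewrite uE ?v_feedback// ?ltW//; apply/eqP; rewrite gt_eqF.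
- rewrite /z (periodE (i := 0)); last by rewrite sampling_timeS sampling_time0 lexx ltrDl.
  by rewrite -(sampling_time0 T t0) flow0.
- move=> th; rewrite in_itv/= => /andP[h1 h2]; rewrite /history /u ifT; last lra.
  by rewrite addrAC subrr add0r.
- move=> th; rewrite in_itv/= => /andP[h1 h2]; rewrite /history /past_plant ifT; last lra.
  by rewrite addrAC subrr add0r.
Unshelve. all: by end_near. Qed.

End existence.

End closed_loop.

(** * Stability of the sampled predictor feedback *)

Theorem theorem2p1 (R : realType) (n m : nat) (T r tau : R)
    (f : 'rV[R]_n -> 'rV[R]_m -> 'rV[R]_n)
    (k : R -> 'rV[R]_n -> 'rV[R]_m) (g : R -> R) (sigma : R -> R -> R)
    (T_gt0 : 0 < T) (r_ge0 : 0 <= r) (tau_ge0 : 0 <= tau)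
    (rtau_gt0 : 0 < r + tau)
    (f_lip : locally_lipschitz f) (f00 : f 0 0 = 0)
    (f_complete : forward_complete f)
    (k_C1 : C1_halfspace k) (g_Kinfty : class_Kinfty g)
    (k_le_g : forall (t : R) (x : 'rV[R]_n),
      0 <= t -> enorm (k t x) <= g (enorm x))
    (sigma_KL : class_KL sigma)
    (k_stab : forall (t0 : R) (x0 : 'rV[R]_n), 0 <= t0 ->
      let solution (x : R -> 'rV[R]_n) :=
        ode_solution `[t0, +oo[ (fun t y => f y (k t y)) x /\ x t0 = x0 in
      (exists x, solution x) /\
      forall x, solution x ->
        forall t, t0 <= t -> enorm (x t) <= sigma (enorm x0) (t - t0)) :
  exists2 sigma' : R -> R -> R, class_KL sigma' &
    forall (t0 : R) (x0 : R -> 'rV[R]_n) (z0 : 'rV[R]_n) (u0 : R -> 'rV[R]_m),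
      0 <= t0 ->
      {within `[- r, 0], continuous x0} ->
      Linfty `[- (r + tau), 0] u0 ->
      let solution := closed_loop_solution f k T r tau t0 x0 z0 u0 in
      (exists x z u, solution x z u) /\
      forall x z u, solution x z u -> forall t, t0 <= t ->
        ((enorm (z t))%:E + sup_norm r (history t x)
           + sup_norm (r + tau) (history t u)
         <= (sigma' (enorm z0 + fine (sup_norm r x0)
                       + fine (sup_norm (r + tau) u0))%R (t - t0)%R)%:E)%E.
Proof.
have [gK _] := g_Kinfty.
have [sigma' sK sP] := closed_loop_stability T_gt0 r_ge0 tau_ge0 f_lip f00
  f_complete k_C1 gK k_le_g sigma_KL k_stab.
exists sigma' => // t0 x0 z0 u0 t00 x0c u0L solution; split.
  exact: (closed_loop_exists T_gt0 r_ge0 tau_ge0 f_lip f_complete k_C1 gK k_le_g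
    k_stab x0 z0 t00 rtau_gt0 u0L).
by move=> x z u sol t t0t; exact: (sP _ _ _ _ _ _ _ t00 x0c u0L sol t t0t).
Qed.
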